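(* Let $G$ be a virtually polycyclic group and let $\varphi\in\operatorname{End}(G)$. If the Reidemeister number $R(\varphi)$ is finite, then the tamed Reidemeister number satisfies $\tilde R(\varphi)=R(\varphi)$.
   Context: For $\varphi\in\operatorname{End}(G)$, elements $g_1,g_2\in G$ are $\varphi$-twisted conjugate if $g_1=hg_2\varphi(h)^{-1}$ for some $h\in G$; $R(\varphi)\in\mathbb{N}\cup\{\infty\}$ is the number of equivalence classes. $\iota_g$ denotes $x\mapsto gxg^{-1}$. For $H\le G$, $\sqrt[G]{H}:=\{g\in G\mid\exists k\in\mathbb{N}: g^k\in H\}$. $\mathcal{NR}$-groups: a polycyclic group $G$ is strongly torsion-free if there is a short exact sequence $1\to K\to G\to\mathbb{Z}^n\to1$ with $K$ finitely generated torsion-free nilpotent. An $\mathcal{NR}$-group is a strongly torsion-free polycyclic group $G$ such that, for $H:=\sqrt[G]{[G,G]}$ and a central series $H=H_1\ge\cdots\ge H_{c+1}=1$ of $H$ with all $H_i$ normal in $G$ and all $H_i/H_{i+1}$ free abelian, for every $g\in G$ and every $i$ the automorphism of $H_i/H_{i+1}$ induced by $\iota_g$ has no root of unity other than $1$ as an eigenvalue (this is independent of the chosen series). Subgroups of $\mathcal{NR}$-groups are $\mathcal{NR}$-groups. Invariant $\tau$: for an $\mathcal{NR}$-group $G$ put $H:=\sqrt[G]{[G,G]}$, $\mathcal F_0(G):=G$, $\mathcal F_i(G):=\sqrt[H]{\gamma_i(H)}$ for $1\le i\le c+1$ (with $\gamma_i$ the lower central series, $\mathcal F_{c+1}(G)=1$).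 These terms are fully invariant and $\mathcal F_i(G)/\mathcal F_{i+1}(G)\cong\mathbb{Z}^{n_i}$ for $0\le i\le c$. For $\varphi\in\operatorname{End}(G)$ inducing $\varphi_i\in\mathbb{Z}^{n_i\times n_i}$ on these factors, $\tau(\varphi):=\prod_{i=0}^c|\det(I_{n_i}-\varphi_i)|$ (the determinant of a $0\times 0$ matrix is $1$). Tamed Reidemeister number: let $G$ be virtually polycyclic and $\varphi\in\operatorname{End}(G)$. Choose a finite index normal $\mathcal{NR}$-subgroup $N$ of $G$ with $\varphi(N)\le N$ (one always exists). Let $P_\varphi$ be the map $[t]_G\mapsto[\varphi(t)]_G$ on the (finite) set of $G$-conjugacy classes of torsion elements of $G$. For each $[t]_G\in\operatorname{Fix}(P_\varphi)$ choose a representative $t$ and $g_t\in G$ with $t=g_t\varphi(t)g_t^{-1}$; set $C_t:=C_G(t)$, $D_t:=C_N(t)$, $\varphi_t:=\iota_{g_t}\varphi$ ($C_t$ and $D_t$ are $\varphi_t$-invariant and $D_t$ is a normal finite index $\mathcal{NR}$-subgroup of $C_t$). Then $$\tilde R(\varphi):=\sum_{[t]_G\in\operatorname{Fix}(P_\varphi)}\frac{1}{[C_t:D_t]}\sum_{cD_t\in C_t/D_t}\tau\big((\iota_c\varphi_t)|_{D_t}\big),$$ which is independent of all choices ($N$, $t$, $g_t$, representatives $c$). *)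

(* Defs.v *)
From HB Require Import structures.
From mathcomp Require Import all_boot all_order all_algebra all_field finmap.
From mathcomp Require Import all_classical.

Set Implicit Arguments.
Unset Strict Implicit.
Unset Printing Implicit Defensive.

Import GRing.Theory Num.Theory.

Local Open Scope classical_set_scope.
Local Open Scope ring_scope.

(* Groups are ambient [groupType]s, possibly infinite; subgroups, and the group
   notions applied to them, are expressed by [set]s of elements of the ambient
   group. *)

Section Groups.
Variable G : groupType.
Implicit Types (A B H K N S X : set G) (f : G -> G) (g h t x y : G).

Definition subgroup A :=
  A 1%g /\ forall x y, A x -> A y -> A (x * y^-1)%g.

Definition generated S : set G := smallest subgroup S.

Definition finitely_generated A :=
  exists2 S, finite_set S & A = generated S.

Definition inner g x : G := (g * x * g^-1)%g.

(* [B] is a normal subgroup of the subgroup [A] *)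
Definition normal_in B A :=
  [/\ subgroup B, B `<=` A & forall a b, A a -> B b -> B (inner a b)].

Definition commutator_subgroup A B : set G :=
  generated [set x | exists a b, [/\ A a, B b & x = [~ a, b]%g]].

(* indexed from 0: [lower_central A i] is gamma_(i+1)(A) *)
Definition lower_central A (i : nat) : set G :=
  iter i (fun B => commutator_subgroup B A) A.

Definition nilpotent A := exists c, lower_central A c = [set 1%g].

Definition nilpotency_class A : nat :=
  xget 0%N [set c | lower_central A c = [set 1%g] /\
    forall k, (k < c)%N -> lower_central A k <> [set 1%g]].

(* the root set of [B] in [A]; exponents are positive, since with exponent 0
   every element would qualify *)
Definition isolator A B : set G :=
  [set x | A x /\ exists2 k, (0 < k)%N & B (x ^+ k)%g].

Definition torsion x := exists2 k, (0 < k)%N & (x ^+ k)%g = 1%g.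

Definition torsion_free A := forall x, A x -> torsion x -> x = 1%g.

Definition left_coset x B : set G := [set (x * b)%g | b in B].

Definition cosets A B : set (set G) := [set left_coset x B | x in A].

Definition finite_index A B := finite_set (cosets A B).

Definition subgroup_index A B : nat := #|` fset_set (cosets A B)|.

(* subnormal series from [A] to 1; [A_ i / A_ i.+1] is cyclic, that is, [A_ i]
   is generated by [A_ i.+1] and one element *)
Definition polycyclic A :=
  exists (n : nat) (A_ : nat -> set G),
    [/\ subgroup A, A_ 0%N = A, A_ n = [set 1%g] &
        forall i, (i < n)%N ->
          normal_in (A_ i.+1) (A_ i) /\
          exists g, A_ i = generated (A_ i.+1 `|` [set g])].

(* exactness of 1 -> B -> A -> Z^n -> 1, where [q] restricted to [A] is the
   surjection; equivalently, [q] induces an isomorphism from A/B to Z^n *)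
Definition Zn_quotient A B n (q : G -> 'rV[int]_n) :=
  [/\ forall x y, A x -> A y -> q (x * y)%g = q x + q y,
      forall v, exists2 x, A x & q x = v,
      B `<=` A
    & forall x, A x -> (q x = 0 <-> B x)].

(* [M] is the matrix, acting on row vectors, of the endomorphism of Z^n
   induced by [f] through [q] *)
Definition induced_mx f A n (q : G -> 'rV[int]_n) (M : 'M[int]_n) :=
  forall x, A x -> q (f x) = q x *m M.

Definition strongly_torsion_free A :=
  exists (K : set G) (n : nat) (q : G -> 'rV[int]_n),
    [/\ Zn_quotient A K q, subgroup K, finitely_generated K,
        torsion_free K & nilpotent K].

Definition only_trivial_root_of_unity f A B :=
  forall n (q : G -> 'rV[int]_n) (M : 'M[int]_n),
    Zn_quotient A B q -> induced_mx f A q M ->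
    forall z : algC, eigenvalue (map_mx intr M) z ->
      (exists2 k, (0 < k)%N & z ^+ k = 1) -> z = 1.

Definition root_commutator A : set G :=
  isolator A (commutator_subgroup A A).

(* The central series is indexed from 0: [H_ 0 = H] and [H_ c = 1]. Its factors
   have finite rank because A is polycyclic. *)
Definition NR_group A :=
  [/\ polycyclic A, strongly_torsion_free A &
    let H := root_commutator A in
    exists (c : nat) (H_ : nat -> set G),
      [/\ H_ 0%N = H, H_ c = [set 1%g],
          forall i, (i <= c)%N -> normal_in (H_ i) A &
          forall i, (i < c)%N ->
            [/\ H_ i.+1 `<=` H_ i,
                commutator_subgroup (H_ i) H `<=` H_ i.+1,
                exists n (q : G -> 'rV[int]_n), Zn_quotient (H_ i) (H_ i.+1) q
              & forall g, A g ->
                  only_trivial_root_of_unity (inner g) (H_ i) (H_ i.+1)]]].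

Definition NR_filtration A (i : nat) : set G :=
  let H := root_commutator A in
  if i is j.+1 then isolator H (lower_central H j) else A.

(* det(I - M) for the matrix M of the endomorphism induced by [f] on A/B; it
   does not depend on the identification of A/B with Z^n. The value is
   meaningful only if A/B is isomorphic to some Z^n and [f] preserves A, B. *)
Definition factor_det f A B : int :=
  xget 0 [set d | exists n (q : G -> 'rV[int]_n) (M : 'M[int]_n),
    [/\ Zn_quotient A B q, induced_mx f A q M & d = \det (1%:M - M)]].

(* tau of the restriction of [f] to the subgroup [A] *)
Definition tau A f : nat :=
  (\prod_(i < (nilpotency_class (root_commutator A)).+1)
     `|factor_det f (NR_filtration A i) (NR_filtration A i.+1)|)%N.

Definition conj_class t : set G := [set x | exists h, x = inner h t].

Definition torsion_classes : set (set G) := conj_class @` torsion.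

(* P_f : [t] |-> [f t], written without choosing a representative *)
Definition class_map f (C : set G) : set G :=
  \bigcup_(t in C) conj_class (f t).

Definition fixed_torsion_classes f : set (set G) :=
  [set C | torsion_classes C /\ class_map f C = C].

Definition centralizer t : set G := [set x | (x * t)%g = (t * x)%g].

Definition virtually_polycyclic :=
  exists2 A, polycyclic A & finite_index setT A.

Definition twisted_class f x : set G :=
  [set y | exists h, y = (h * x * (f h)^-1)%g].

Definition reidemeister_classes f : set (set G) := range (twisted_class f).

Definition reidemeister_finite f := finite_set (reidemeister_classes f).

(* the Reidemeister number, when it is finite *)
Definition reidemeister_number f : nat :=
  #|` fset_set (reidemeister_classes f)|.

(* All the choices entering the definition of the tamed Reidemeister number:
   a subgroup [tame_N], a representative [tame_t C] of each fixed torsion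
   class [C], an element [tame_g C] witnessing that [C] is fixed, and a
   representative [tame_c C X] of each coset [X] of D_t in C_t. Outside these
   domains the values of the functions are irrelevant. *)
Record tamed_choice f := TamedChoice {
  tame_N : set G;
  tame_t : set G -> G;
  tame_g : set G -> G;
  tame_c : set G -> set G -> G;
  tame_N_normal : normal_in tame_N setT;
  tame_N_finite_index : finite_index setT tame_N;
  tame_N_NR : NR_group tame_N;
  tame_N_stable : forall x, tame_N x -> tame_N (f x);
  tame_t_in : forall C, fixed_torsion_classes f C -> C (tame_t C);
  tame_t_fix : forall C, fixed_torsion_classes f C ->
    tame_t C = inner (tame_g C) (f (tame_t C));
  tame_c_in : forall C X, fixed_torsion_classes f C ->
    cosets (centralizer (tame_t C)) (centralizer (tame_t C) `&` tame_N) X ->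
    X (tame_c C X)
}.

Definition tamed_term f (d : tamed_choice f) (C : set G) : rat :=
  let Ct := centralizer (tame_t d C) in
  let Dt := Ct `&` tame_N d in
  let ft := inner (tame_g d C) \o f in
  (subgroup_index Ct Dt)%:R^-1 *
  \sum_(X \in cosets Ct Dt) ((tau Dt (inner (tame_c d C X) \o ft))%:R : rat).

(* Both index sets of the nested sums are finite when G is virtually
   polycyclic. *)
Definition tamed_reidemeister f (d : tamed_choice f) : rat :=
  \sum_(C \in fixed_torsion_classes f) tamed_term d C.

End Groups.

(* Main.v *)
Require Import Defs.
From mathcomp Require Import all_boot all_order all_algebra all_field finmap.
From mathcomp Require Import all_classical.

(* Let N be the chosen NR-subgroup. G acts on G by twisted conjugation, and on
   the set of pairs (t, x) with t = x phi(t) x^-1, i.e. with t in the stabilizer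
   of x. If R(phi) is finite, N acts with finitely many orbits, so that every
   R(iota_x phi |N) is finite; for an NR-group this forces iota_x phi |N to have
   no fixed point but 1, hence N acts freely and the stabilizers are finite.
   Counting the N-orbits of pairs over the G-orbits of x gives [G : N] R(phi);
   counting them over the conjugacy classes of t, which are torsion classes
   fixed by phi, gives [G : N] times the tamed Reidemeister number, provided
   that R = tau for endomorphisms psi of subgroups D of N with R(psi) finite.

   The latter is proved along the filtration F_i of D: the classes modulo
   F_(i+1) above the class of x modulo F_i form the cokernel of
   1 - iota_x psi on F_i / F_(i+1) = Z^n, as no fixed points come from the
   previous factors. Its order, the absolute value of a determinant, does not
   depend on x. Indeed let P, X be the matrices of psi, iota_x. The trace of
   (P X^j)^k is tr(P^k Y^j), where Y is the matrix of iota_y,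
   y = x psi(x) .. psi^(k-1)(x). It is periodic in j, since some power of x is
   z psi(z)^-1 modulo F_1; but Y has no nontrivial root of unity as eigenvalue,
   so the trace is constant in j, and P X and P have the same characteristic
   polynomial. *)

Set Implicit Arguments.
Unset Strict Implicit.
Unset Printing Implicit Defensive.

Import Order.TTheory GRing.Theory Num.Theory.

Local Open Scope classical_set_scope.
Local Open Scope ring_scope.

(** * Traces of powers and determinants *)

(** Equal power sums give equal sums of [p.[x]] for every polynomial [p]. A [p] whose roots are the
    values of [s ++ t] other than [a] isolates the multiplicity of [a]; characteristic 0 then lets
    the multiplicities be compared. *)
Lemma perm_eq_power_sums (F : numFieldType) (s t : seq F) :
  (forall k, \sum_(x <- s) x ^+ k = \sum_(x <- t) x ^+ k) -> perm_eq s t.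
Proof.
move=> eq_st.
have eq_horner (p : {poly F}) : \sum_(x <- s) p.[x] = \sum_(x <- t) p.[x].
  under eq_bigr do rewrite horner_coef.
  rewrite exchange_big; under [RHS]eq_bigr do rewrite horner_coef.
  rewrite [RHS]exchange_big; apply: eq_bigr => i _.
  by rewrite -!mulr_sumr eq_st.
apply/allP => a _ /=.
pose p := \prod_(b <- rem a (undup (s ++ t))) ('X - b%:P).
have rem_mem b : b \in s ++ t -> b != a -> b \in rem a (undup (s ++ t)).
  by move=> b_st ba; rewrite mem_rem_uniq ?undup_uniq// inE ba mem_undup.
have pa_neq0 : p.[a] != 0.
  rewrite -[_ == 0]/(root p a) root_prod_XsubC.
  by rewrite mem_rem_uniq ?undup_uniq// inE eqxx.
have sum_count (u : seq F) : {subset u <= s ++ t} ->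
    \sum_(x <- u) p.[x] = (count_mem a u)%:R * p.[a].
  elim: u => [|b u IHu] sub; first by rewrite big_nil mul0r.
  rewrite big_cons IHu; last by move=> x xu; apply: sub; rewrite inE xu orbT.
  rewrite /= natrD mulrDl; congr (_ + _).
  have [->|ba] := eqVneq b a; first by rewrite mul1r.
  rewrite mul0r; apply/rootP; rewrite root_prod_XsubC rem_mem//.
  by rewrite sub// inE eqxx.
have := eq_horner p.
rewrite !sum_count; try by move=> x xu; rewrite mem_cat xu ?orbT.
by move=> /(mulIf pa_neq0)/eqP; rewrite eqr_nat.
Qed.

Lemma mxtrace_conj (R : comUnitRingType) n (P A : 'M[R]_n) :
  P \in unitmx -> \tr (P *m A *m invmx P) = \tr A.
Proof. by move=> Pu; rewrite mxtrace_mulC mulmxA mulVmx// mul1mx. Qed.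

Lemma det_conj (R : comUnitRingType) n (P A : 'M[R]_n) :
  P \in unitmx -> \det (P *m A *m invmx P) = \det A.
Proof.
by move=> Pu; rewrite !det_mulmx mulrAC -det_mulmx mulmxV// det1 mul1r.
Qed.

Lemma trig_expr (R : comNzRingType) n (T : 'M[R]_n.+1) k : is_trig_mx T ->
  is_trig_mx (T ^+ k) /\ forall i, (T ^+ k) i i = T i i ^+ k.
Proof.
move=> /is_trig_mxP Tt; elim: k => [|k [/is_trig_mxP IHt IHd]].
  rewrite expr0; split=> [|i]; last by rewrite mxE eqxx.
  by apply/is_trig_mxP => i j ij; rewrite mxE -val_eqE ltn_eqF.
rewrite exprS; split.
  apply/is_trig_mxP => i j ij; rewrite mxE big1// => l _.
  have [il|li] := ltnP i l; first by rewrite Tt// mul0r.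
  by rewrite IHt ?mulr0// (leq_ltn_trans li).
move=> i; rewrite mxE (bigD1 i)//= big1 ?addr0 ?IHd ?exprS// => l.
rewrite neq_ltn => /orP[li|il]; first by rewrite IHt ?mulr0.
by rewrite Tt ?mul0r.
Qed.

Lemma expr_conj (R : comUnitRingType) n (P A : 'M[R]_n.+1) k :
  P \in unitmx -> (P *m A *m invmx P) ^+ k = P *m A ^+ k *m invmx P.
Proof.
move=> Pu; elim: k => [|k IHk]; first by rewrite !expr0 mulmx1 mulmxV.
by rewrite !exprS IHk -!mulmxE !mulmxA mulmxKV.
Qed.

(** After Schur triangularization, the traces of the powers and the determinant depend only on the
    multiset of diagonal entries, which the power sums determine. *)
Lemma det_sub1_traces n (A B : 'M[algC]_n.+1) :
  (forall k, \tr (A ^+ k) = \tr (B ^+ k)) -> \det (1 - A) = \det (1 - B).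
Proof.
have triang (M : 'M[algC]_n.+1) : exists2 s : seq algC,
    forall k, \tr (M ^+ k) = \sum_(x <- s) x ^+ k &
    \det (1 - M) = \prod_(x <- s) (1 - x).
  have [P /unitarymx_unit Pu] := @Schur _ _ M isT.
  rewrite /similar_to /= conjumx// => Tt.
  set T := P *m M *m invmx P in Tt.
  exists [seq T i i | i <- index_enum 'I_n.+1] => [k|].
    rewrite -(mxtrace_conj _ Pu) -expr_conj// -/T big_map.
    by apply: eq_bigr => i _; rewrite (trig_expr k Tt).2.
  rewrite -(det_conj _ Pu) mulmxBr mulmx1 mulmxBl mulmxV// -/T.
  clearbody T.
  rewrite det_trig ?big_map.
    by apply: eq_bigr => i _; rewrite !mxE eqxx.
  apply/is_trig_mxP => i j ij; rewrite !mxE (is_trig_mxP Tt)// subr0.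
  by rewrite -val_eqE ltn_eqF.
have [s As ->] := triang A; have [t Bt ->] := triang B => eq_tr.
by apply: perm_big; apply: perm_eq_power_sums => k; rewrite -As -Bt.
Qed.

(* As polynomials in the shift, both [char_poly Y] and [X^m - 1] kill the
   sequence [j |-> \tr (P *m Y ^+ j)]; their only common root is 1. *)
Lemma trace_periodic n (P Y : 'M[algC]_n.+1) m : (0 < m)%N ->
  (forall z, eigenvalue Y z -> (exists2 k, (0 < k)%N & z ^+ k = 1) -> z = 1) ->
  (forall j, \tr (P *m Y ^+ (j + m)) = \tr (P *m Y ^+ j)) ->
  \tr (P *m Y) = \tr P.
Proof.
move=> m_gt0 eigY perY; pose Q : {poly algC} := \sum_(i < m) 'X^i.
have QE : 'X^m - 1 = ('X - 1) * Q :> {poly algC} by rewrite subrX1.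
have cop : coprimep (char_poly Y) Q.
  apply/Pdiv.ClosedField.coprimepP => z; rewrite -eigenvalue_root_char => eigz.
  apply/negP => Qz.
  have z1 : z ^+ m = 1.
    apply/eqP; rewrite -subr_eq0; have /(congr1 (horner^~ z)) := QE.
    by rewrite hornerM (rootP Qz) mulr0 !hornerE => ->.
  have {}z1 : z = 1 by apply: eigY => //; exists m.
  move: Qz; rewrite z1 /root horner_sum.
  under eq_bigr do rewrite hornerXn expr1n.
  by rewrite sumr_const card_ord pnatr_eq0 eqn0Ngt m_gt0.
have [[u v] /= uv1] := Bezout_eq1_coprimepP _ _ cop.
have X1E : 'X - 1 = u * ('X - 1) * char_poly Y + v * ('X^m - 1) :> {poly algC}.
  by rewrite QE mulrAC mulrCA mulrC -mulrDr uv1 mulr1.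
pose L p := \tr (P *m horner_mx Y p).
have LD p q : L (p + q) = L p + L q by rewrite /L rmorphD mulmxDr mxtraceD.
suff: L ('X - 1) = 0.
  rewrite /L rmorphB rmorph1 /= horner_mx_X mulmxBr mulmx1 linearB /=.
  by move/subr0_eq.
rewrite X1E LD.
rewrite {1}/L rmorphM /= Cayley_Hamilton mulr0 mulmx0 linear0 add0r.
rewrite -[v]coefK poly_def mulr_suml.
apply: (big_ind (fun p => L p = 0)) => [|p q Lp Lq|i _].
- by rewrite /L rmorph0 mulmx0 linear0.
- by rewrite LD Lp Lq addr0.
rewrite /L -scalerAl linearZ /= -scalemxAr linearZ /= mulrBr mulr1 -exprD.
rewrite rmorphB !rmorphXn /= horner_mx_X mulmxBr linearB /= perY subrr.
by rewrite mulr0.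
Qed.

(** Matrix form of the eigenvalue condition in [NR_group]. *)
Definition no_root_of_unity n (Y : 'M[int]_n) :=
  forall z : algC, eigenvalue (map_mx intr Y) z ->
    (exists2 k, (0 < k)%N & z ^+ k = 1) -> z = 1.

(** The trace of [(P * X ^+ j) ^+ k] is that of [P ^+ k * Y k ^+ j], and the conjugacies make it
    periodic in [j]. By [trace_periodic] its values at [j = 1] and [j = 0] agree, so [P * X] and [P]
    have the same traces of powers. *)
Lemma det_sub1_twist n (P X : 'M[int]_n.+1) (Y : nat -> 'M[int]_n.+1) m :
    (0 < m)%N -> (forall k, no_root_of_unity (Y k)) ->
    (forall k j, (P * X ^+ j) ^+ k = P ^+ k * Y k ^+ j) ->
    (forall j, exists2 Z : 'M[int]_n.+1, Z \is a GRing.unit &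
       P * X ^+ (j + m) = Z * (P * X ^+ j) * Z^-1) ->
  \det (1 - P * X) = \det (1 - P).
Proof.
move=> m_gt0 eigY powE per.
have trper k j : \tr ((P * X ^+ (j + m)) ^+ k) = \tr ((P * X ^+ j) ^+ k).
  have [Z Zu ->] := per j.
  by rewrite [X in X ^+ k](_ : _ = Z *m (P * X ^+ j) *m invmx Z)//
    expr_conj// mxtrace_conj.
apply: (@intr_inj algC); rewrite -!det_map_mx !rmorphB /= !rmorph1.
apply: det_sub1_traces => k; rewrite -!rmorphXn /= !trace_map_mx.
have -> : (P * X) ^+ k = P ^+ k * Y k by rewrite -{1}[X]expr1 powE expr1.
rewrite -!trace_map_mx rmorphM /=.
refine (trace_periodic m_gt0 (eigY k) _) => j.
have trE i : \tr (map_mx intr (P ^+ k) *m map_mx intr (Y k) ^+ i) =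
    (\tr ((P * X ^+ i) ^+ k))%:~R :> algC.
  rewrite powE -trace_map_mx rmorphM /=; congr (\tr (_ * _)).
  by rewrite [RHS]rmorphXn.
by rewrite !trE trper.
Qed.

(** * Finite cardinals and cokernels *)

(** The value on infinite sets is the default 0, so counts come together with finiteness.
    [subgroup_index] and [reidemeister_number] unfold to it. *)
Definition ncard (T : choiceType) (A : set T) : nat := #|` fset_set A|.

Lemma card_eq_ncard (T U : choiceType) (A : set T) (B : set U) :
  (A #= B)%card -> finite_set A -> finite_set B /\ ncard A = ncard B.
Proof.
move=> AB /[dup] Afin [n An]; have Bn : (B #= `I_n)%card.
  by apply: card_eq_trans An; rewrite card_eq_sym.
by split; [exists n | rewrite /ncard (card_fset_set An) (card_fset_set Bn)].
Qed.

(** Both images are the quotient of [A] by one equivalence relation. Sets of orbits, cosets and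
    twisted classes are compared in this way below. *)
Lemma card_eq_image (T : choiceType) (U V : Type) (A : set T)
    (f : T -> U) (g : T -> V) :
  (forall x y, A x -> A y -> f x = f y <-> g x = g y) ->
  (f @` A #= g @` A)%card.
Proof.
move=> fg; have [->|/set0P[a Aa]] := eqVneq A set0.
  by rewrite !image_set0 card_eq00.
pose s u := xget a [set x | A x /\ f x = u].
have sP x : A x -> A (s (f x)) /\ f (s (f x)) = f x.
  by move=> Ax; rewrite /s; case: xgetP => [_ ->//|/(_ x)[]].
have -> : g @` A = (g \o s) @` (f @` A).
  apply/seteqP; split=> [_ [x Ax <-]|_ [_ [x Ax <-] <-]].
    exists (f x); first by exists x.
    by have [As fs] := sP _ Ax; apply/fg.
  by exists (s (f x)) => //; case: (sP _ Ax).
apply/card_esym/inj_card_eq => _ _ /set_mem[x Ax <-] /set_mem[y Ay <-] /= gs.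
have [[Ax' <-] [Ay' <-]] := (sP _ Ax, sP _ Ay).
by apply/fg.
Qed.

Lemma ncard_fibres (T U : choiceType) (f : T -> U) (A : set T) :
  finite_set A ->
  ncard A =
    (\sum_(b <- fset_set (f @` A)) ncard (A `&` f @^-1` [set b]))%N.
Proof.
move=> Afin; rewrite /ncard card_fset_sum1.
rewrite (partition_big_imfset _ f) /= fset_set_image//; apply: eq_bigr => b _.
rewrite card_fset_sum1 -big_filter; apply: perm_big.
apply: uniq_perm; rewrite ?filter_uniq ?fset_uniq// => x.
rewrite mem_filter !in_fset_set//; last exact: finite_setIl.
apply/andP/idP => [[/eqP fx /set_mem Ax]|/set_mem[Ax fx]].
  by apply/mem_set.
by split; [apply/eqP | apply/mem_set].
Qed.

Lemma ncard_uniform_fibres (T U : choiceType) (f : T -> U) (A : set T) d :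
  finite_set A ->
  (forall b, (f @` A) b -> ncard (A `&` f @^-1` [set b]) = d) ->
  ncard A = (ncard (f @` A) * d)%N.
Proof.
move=> Afin fib; rewrite (ncard_fibres f Afin).
rewrite (eq_big_seq (fun=> d)) => [|b]; last first.
  by rewrite in_fset_set ?inE; [exact: fib | exact: finite_image].
by rewrite big_const_seq count_predT iter_addn_0 mulnC.
Qed.

Lemma ncardX (T U : choiceType) (A : set T) (B : set U) :
  finite_set A -> finite_set B -> ncard (A `*` B) = (ncard A * ncard B)%N.
Proof.
move=> fA fB; have [->|/set0P[b Bb]] := eqVneq B set0.
  by rewrite setX0 /ncard !fset_set0 !cardfs0 muln0.
have AE : fst @` (A `*` B) = A.
  by apply/seteqP; split=> [_ [[x y] [Ax _] <-]//|x Ax]; exists (x, b).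
rewrite (@ncard_uniform_fibres _ _ fst _ (ncard B)) ?AE//.
  exact: finite_setX.
move=> a Aa; have -> : A `*` B `&` fst @^-1` [set a] = pair a @` B.
  apply/seteqP; split=> [[x y] [[/= Ax By] /= <-]|_ [y By <-]//].
  by exists y.
have BE : (B #= pair a @` B)%card by apply/card_esym/inj_card_eq => x y _ _ [].
by have [] := card_eq_ncard BE fB.
Qed.

Lemma ncard_gt0 (T : choiceType) (A : set T) x : finite_set A -> A x ->
  (0 < ncard A)%N.
Proof.
move=> fA Ax; rewrite /ncard cardfs_gt0; apply/fset0Pn; exists x.
by rewrite in_fset_set ?inE.
Qed.

Lemma ncard_finset (T : finType) (U : choiceType) (P : {pred T}) (h : T -> U) :
  {in P &, injective h} -> ncard [set h x | x in [set` P]] = #|P|.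
Proof.
move=> h_inj; have hP : ([set` P] #= h @` [set` P])%card.
  by apply/card_esym/inj_card_eq => x y /set_mem xP /set_mem yP; apply: h_inj.
have [_ <-] := card_eq_ncard hP (finite_finpred P).
rewrite /ncard -(card_finset P); congr #|` _|.
by apply/fsetP => x; rewrite in_fset_set// !inE; apply/idP/idP; rewrite inE.
Qed.

Lemma absz_unit (u : int) : u \is a GRing.unit -> `|u|%N = 1%N.
Proof. by rewrite qualifE => /orP[]/eqP->. Qed.

(** The box is the set of normal forms for the cokernel of a diagonal matrix; it is counted as a
    family of functions into a common ordinal. *)
Lemma ncard_box n (e : 'I_n -> nat) :
  let box := [set v : 'rV[int]_n | forall i, 0 <= v 0 i < (e i)%:Z] in
  finite_set box /\ ncard box = (\prod_i e i)%N.
Proof.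
move=> box; pose M := \max_i e i.
pose h (f : {ffun 'I_n -> 'I_M.+1}) : 'rV[int]_n := \row_i (f i : nat)%:Z.
pose P := family (fun i => [pred j : 'I_M.+1 | (j < e i)%N]).
have boxE : box = [set h f | f in [set` P]].
  apply/seteqP; split=> [v vbox|_ [f /familyP fP <-] i]; last first.
    by rewrite mxE /= ltz_nat; apply: fP.
  have lt_ve i : (`|v ord0 i| < e i)%N.
    by have /andP[v0 ve] := vbox i; rewrite -ltz_nat gez0_abs.
  exists [ffun i => inord `|v ord0 i|%N] => [/=|].
    apply/familyP => i; rewrite ffunE inE inordK//.
    by rewrite ltnS ltnW// (leq_trans (lt_ve i))// /M leq_bigmax.
  apply/rowP => i; rewrite mxE ffunE inordK ?gez0_abs//.
    by have /andP[] := vbox i.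
  by rewrite ltnS ltnW// (leq_trans (lt_ve i))// /M leq_bigmax.
split; first by rewrite boxE; apply: finite_image; apply: finite_finset.
rewrite boxE ncard_finset => [|f f' _ _ /rowP ff']; last first.
  by apply/ffunP => i; apply/val_inj; have := ff' i; rewrite !mxE => -[].
rewrite card_family foldrE big_map big_enum /=; apply: eq_bigr => i _.
rewrite -[RHS]card_ord -!sum1_card (big_ord_widen M.+1 (fun=> 1%N))//.
by rewrite ltnW// ltnS leq_bigmax.
Qed.

(** The cokernel is presented by any [g] whose fibres are the cosets of the row lattice of [A]. With
    the Smith form [A = L D R], the vector [v R^-1] reduced modulo the [d_i] is a complete
    invariant, and its values fill a box with [|\det A|] points. *)
Lemma ncard_coker (U : choiceType) n (A : 'M[int]_n) (g : 'rV[int]_n -> U) :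
  (forall v w, g v = g w <-> exists u, v - w = u *m A) ->
  finite_set (range g) ->
  \det A != 0 /\ ncard (range g) = `|\det A|%N.
Proof.
move=> gP gfin.
have [L Lu [R Ru [d _ AE]]] := int_Smith_normal_form A.
set D := \matrix_(i, j) _ in AE.
have DE : D = diag_mx (\row_i d`_i).
  by apply/matrixP => i j; rewrite !mxE -val_eqE.
pose Ri : 'M[int]_n := invmx R.
have RK m (B : 'M[int]_(m, n)) : B *m R *m Ri = B by exact: mulmxK.
have RVK m (B : 'M[int]_(m, n)) : B *m Ri *m R = B by exact: mulmxKV.
have mulD (u : 'rV_n) i : (u *m D) 0 i = u 0 i * d`_i.
  by rewrite DE mul_mx_diag !mxE.
pose g0 (v : 'rV[int]_n) : 'rV[int]_n :=
  \row_i ((v *m Ri) ord0 i %% d`_i)%Z.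
have gg0 v w : g v = g w <-> g0 v = g0 w.
  rewrite gP; split=> [[u vw]|/rowP g0E].
    apply/rowP => i; rewrite !mxE; apply/eqP; rewrite eqz_mod_dvd.
    have vwE : v *m Ri - w *m Ri = u *m L *m D.
      by rewrite -mulmxBl vw AE !mulmxA RK.
    by have := congr1 (fun z : 'rV_n => z 0 i) vwE; rewrite mulD !mxE => ->;
      exact: dvdz_mull.
  have divd i : (d`_i %| ((v - w) *m Ri) ord0 i)%Z.
    by rewrite mulmxBl; have := g0E i; rewrite !mxE => /eqP;
      rewrite eqz_mod_dvd.
  pose u : 'rV[int]_n := \row_i (((v - w) *m Ri) ord0 i %/ d`_i)%Z.
  exists (u *m invmx L); rewrite AE !mulmxA mulmxKV//.
  rewrite -[LHS]RVK; congr (_ *m R).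
  apply/rowP => i; rewrite mulD [u _ _]mxE; exact/esym/divzK.
have card_gg0 : (range g #= range g0)%card.
  by apply: card_eq_image => v w _ _; exact: gg0.
have [g0fin ->] := card_eq_ncard card_gg0 gfin.
(* Reduction modulo 0 is the identity in [modz], so a zero [d_i] would keep all multiples of one
   basis vector apart. *)
have d_neq0 (i : 'I_n) : d`_i != 0.
  apply/eqP => di0; apply: infinite_nat.
  pose h k := g0 ((k%:Z *: delta_mx 0 i) *m R).
  have hE k : h k 0 i = k%:Z.
    by rewrite mxE RK// di0 modz0 !mxE !eqxx mulr1.
  rewrite -(@eq_finite_set _ _ (range h)); last first.
    by apply: inj_card_eq => k l _ _ hkl; have := hE k; rewrite hkl hE => -[].
  by apply: sub_finite_set g0fin => _ [k _ <-];
    exists (k%:Z *: delta_mx 0 i *m R).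
pose e (i : 'I_n) : int := d`_i.
have absz_det : `|\det A|%N = (\prod_(i < n) `|e i|)%N.
  rewrite AE !det_mulmx !abszM (absz_unit Lu) (absz_unit Ru) mul1n muln1.
  rewrite DE det_diag (big_morph absz abszM (erefl _)).
  by apply: eq_bigr => i _; rewrite mxE.
split; first by rewrite -absz_eq0 absz_det -lt0n; apply: prodn_gt0 => i;
  rewrite absz_gt0; apply: d_neq0.
rewrite absz_det -(ncard_box (fun i => `|e i|%N)).2; congr ncard.
apply/seteqP; split=> [_ [v _ <-] i|v vbox].
  by rewrite mxE modz_ge0//= ltz_mod.
exists (v *m R) => //; apply/rowP => i; rewrite mxE RK//.
have /andP[v0 vd] := vbox i; rewrite -modz_abs modz_small ?v0//.
Qed.

(** * Subgroups, isolators and central series *)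

Section Subgroups.
Variable G : groupType.
Implicit Types (A B H K N S V : set G) (x y g h : G).
Local Open Scope group_scope.

Lemma subgroup1 A : subgroup A -> A 1. Proof. by case. Qed.

Lemma subgroupV A x : subgroup A -> A x -> A x^-1.
Proof. by move=> [A1 AF] Ax; rewrite -[x^-1]mul1g; apply: AF. Qed.

Lemma subgroupM A x y : subgroup A -> A x -> A y -> A (x * y).
Proof.
by move=> sA Ax Ay; rewrite -[y]invgK; apply: (sA.2) => //; apply: subgroupV.
Qed.

Lemma subgroupX A x k : subgroup A -> A x -> A (x ^+ k).
Proof.
move=> sA Ax; elim: k => [|k IHk]; first exact: subgroup1.
by rewrite expgS; apply: subgroupM.
Qed.

Lemma subgroupJ A x y : subgroup A -> A x -> A y -> A (x ^ y).
Proof.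
move=> sA Ax Ay; rewrite conjgE.
by do 2?[apply: subgroupM => //]; apply: subgroupV.
Qed.

Lemma subgroupR A x y : subgroup A -> A x -> A y -> A [~ x, y].
Proof.
move=> sA Ax Ay; rewrite commgEl.
by apply: subgroupM => //; [apply: subgroupV | apply: subgroupJ].
Qed.

Lemma subgroupT : subgroup [set: G]. Proof. by []. Qed.

Lemma subgroup_set1 : subgroup [set 1 : G].
Proof. by split=> // x y -> ->; rewrite /= mulgV. Qed.

Lemma subgroupI A B : subgroup A -> subgroup B -> subgroup (A `&` B).
Proof.
move=> sA sB; split=> [|x y [Ax Bx] [Ay By]]; first by split; apply: subgroup1.
by split; [apply: sA.2 | apply: sB.2].
Qed.

Lemma generated_subgroup S : subgroup (generated S).
Proof.
split=> [C [[]]//|x y Sx Sy C CP].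
by apply: (CP.1.2); [apply: Sx | apply: Sy].
Qed.

Lemma sub_generated S : S `<=` generated S.
Proof. by move=> x Sx C [_]; apply. Qed.

Lemma generated_min S A : subgroup A -> S `<=` A -> generated S `<=` A.
Proof. by move=> sA SA x; apply. Qed.

Lemma generatedS S T : S `<=` T -> generated S `<=` generated T.
Proof.
move=> ST; apply: generated_min; first exact: generated_subgroup.
by move=> x /ST; apply: sub_generated.
Qed.

Lemma commutator_sub A B x y : A x -> B y -> commutator_subgroup A B [~ x, y].
Proof. by move=> Ax By; apply: sub_generated; exists x, y. Qed.

Lemma commutator_min A B C : subgroup C ->
  (forall x y, A x -> B y -> C [~ x, y]) -> commutator_subgroup A B `<=` C.
Proof.
by move=> sC AB; apply: generated_min => // _ [a [b [Aa Bb ->]]]; apply: AB.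
Qed.

Lemma morph_mul1 (f : G -> G) : (forall x y, f (x * y) = f x * f y) -> f 1 = 1.
Proof. by move=> fM; apply: (mulgI (f 1)); rewrite -fM !mulg1. Qed.

Lemma morph_mulV (f : G -> G) : (forall x y, f (x * y) = f x * f y) ->
  forall x, f x^-1 = (f x)^-1.
Proof.
by move=> fM x; apply: (mulgI (f x)); rewrite -fM !mulgV morph_mul1.
Qed.

Lemma innerE g x : inner g x = x ^ g^-1.
Proof. by rewrite /inner conjgE invgK mulgA. Qed.

Lemma innerM g x y : inner g (x * y) = inner g x * inner g y.
Proof. by rewrite !innerE conjMg. Qed.

Lemma normal_subgroup B A : normal_in B A -> subgroup B. Proof. by case. Qed.

Lemma normal_sub B A : normal_in B A -> B `<=` A. Proof. by case. Qed.

Lemma normal_inner B A g x : normal_in B A -> A g -> B x -> B (inner g x).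
Proof. by move=> [_ _ + *]; apply. Qed.

Lemma normalJ B A g x : subgroup A -> normal_in B A -> A g -> B x -> B (x ^ g).
Proof.
move=> sA [_ _ nB] Ag Bx; rewrite -[g]invgK -innerE.
by apply: nB => //; apply: subgroupV.
Qed.

Lemma normalS A B K : normal_in B A -> subgroup K -> B `<=` K -> K `<=` A ->
  normal_in B K.
Proof. by move=> [sB _ nB] sK BK KA; split=> // a b /KA; apply: nB. Qed.

Lemma normal_refl A : subgroup A -> normal_in A A.
Proof.
move=> sA; split=> // a b Aa Ab; rewrite innerE.
by apply: subgroupJ => //; apply: subgroupV.
Qed.

Lemma normal_commr B A x y : subgroup A -> normal_in B A ->
  B x -> A y -> B [~ x, y].
Proof.
move=> sA nB Bx Ay; have sB := normal_subgroup nB.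
rewrite commgEl.
by apply: subgroupM => //; [apply: subgroupV | apply: (normalJ sA nB)].
Qed.

Definition eqmod V x y := V (x * y^-1).

(** * Congruence modulo a normal subgroup *)

Section Eqmod.
Variables (V K : set G).
Hypotheses (sK : subgroup K) (nV : normal_in V K).
Let sV : subgroup V := normal_subgroup nV.

Lemma eqmod_refl x : eqmod V x x.
Proof. by rewrite /eqmod mulgV; apply: subgroup1. Qed.

Lemma eqmod_sym x y : eqmod V x y -> eqmod V y x.
Proof. by move=> /(subgroupV sV); rewrite invgF. Qed.

Lemma eqmod_trans y x z : eqmod V x y -> eqmod V y z -> eqmod V x z.
Proof. by move=> Vxy /(subgroupM sV Vxy); rewrite mulgA mulgVK. Qed.

Lemma eqmod_mem x y : eqmod V x y -> V x <-> V y.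
Proof.
move=> xy; split=> [Vx|Vy]; last first.
  by rewrite -[x](mulgVK y); apply: subgroupM.
by rewrite -[y](mulgVK x); apply: subgroupM => //; apply: eqmod_sym.
Qed.

Lemma eqmodM x x' y y' : K x ->
  eqmod V x x' -> eqmod V y y' -> eqmod V (x * y) (x' * y').
Proof.
move=> Kx xx yy; rewrite /eqmod.
have -> : x * y * (x' * y')^-1 = inner x (y * y'^-1) * (x * x'^-1).
  by rewrite /inner !gnorm.
by apply: subgroupM => //; apply: (normal_inner nV).
Qed.

Lemma eqmodC x y : K x -> K y -> V [~ x, y] -> eqmod V (x * y) (y * x).
Proof.
move=> Kx Ky Vxy; rewrite /eqmod.
have -> : x * y * (y * x)^-1 = inner (y * x) [~ x, y].
  by rewrite /inner commgEl conjgE !gnorm.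
by apply: (normal_inner nV) => //; apply: subgroupM.
Qed.

Lemma eqmod_expMn x y k : K x -> K y ->
    (forall a b, K a -> K b -> V [~ a, b]) ->
  eqmod V ((x * y) ^+ k) (x ^+ k * y ^+ k).
Proof.
move=> Kx Ky KV; elim: k => [|k IHk]; first by rewrite mulg1; apply: eqmod_refl.
rewrite !expgS; have Kxy := subgroupM sK Kx Ky.
have [Kxk Kyk] := (subgroupX k sK Kx, subgroupX k sK Ky).
apply: (@eqmod_trans (x * y * (x ^+ k * y ^+ k))).
  by apply: eqmodM => //; apply: eqmod_refl.
rewrite -!mulgA; apply: eqmodM => //; first exact: eqmod_refl.
rewrite !mulgA; apply: eqmodM; [exact: subgroupM| |exact: eqmod_refl].
by apply: eqmodC => //; apply: KV.
Qed.

Lemma eqmod_commX x y k : K x -> K y ->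
    (forall z, K z -> V [~ [~ x, y], z]) ->
  eqmod V [~ x ^+ k, y] ([~ x, y] ^+ k).
Proof.
move=> Kx Ky cen; have Kw := subgroupR sK Kx Ky.
elim: k => [|k IHk]; first by rewrite comm1g; apply: eqmod_refl.
rewrite !expgS.
have -> : [~ x * x ^+ k, y] = [~ x, y] ^ (x ^+ k) * [~ x ^+ k, y].
  by rewrite !commgEl !conjgE !gnorm.
have Kxk := subgroupX k sK Kx.
apply: eqmodM => //; first exact: subgroupJ.
rewrite /eqmod; set w := [~ x, y] in cen Kw *.
have -> : w ^ (x ^+ k) * w^-1 = inner w [~ w, x ^+ k].
  by clearbody w; rewrite /inner commgEl !conjgE !gnorm.
by apply: (normal_inner nV) => //; apply: cen.
Qed.

End Eqmod.

Lemma isolator_sub A B : isolator A B `<=` A. Proof. by move=> x []. Qed.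

Lemma sub_isolator A B : B `<=` A -> B `<=` isolator A B.
Proof. by move=> BA x Bx; split; [apply: BA | exists 1%N]. Qed.

Lemma isolatorP A B x k : (0 < k)%N -> A x -> isolator A B (x ^+ k) ->
  isolator A B x.
Proof.
move=> k_gt0 Ax [_ [l l_gt0]]; rewrite -expgnA => Bx; split=> //.
by exists (k * l)%N; rewrite ?muln_gt0 ?k_gt0.
Qed.

Lemma isolatorS A B B' : B `<=` B' -> isolator A B `<=` isolator A B'.
Proof.
by move=> BB' x [Ax [k k0 Bx]]; split=> //; exists k => //; apply: BB'.
Qed.

Lemma isolator_conj A B K : (forall g x, K g -> A x -> A (inner g x)) ->
  (forall g x, K g -> B x -> B (inner g x)) ->
  forall g x, K g -> isolator A B x -> isolator A B (inner g x).
Proof.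
move=> nA nB g x Kg [Ax [k k0 Bx]]; split; first exact: nA.
by exists k => //; rewrite innerE -conjXg -innerE; apply: nB.
Qed.

Lemma isolator_abelian K V : subgroup K -> normal_in V K ->
  (forall a b, K a -> K b -> V [~ a, b]) -> subgroup (isolator K V).
Proof.
move=> sK nV KV; have sV := normal_subgroup nV.
split=> [|x y [Kx [k k0 Vx]] [Ky [l l0 Vy]]].
  by apply: sub_isolator; [exact: normal_sub nV | exact: subgroup1].
have KyV := subgroupV sK Ky.
split; first exact: subgroupM.
exists (k * l)%N; first by rewrite muln_gt0 k0.
apply/(eqmod_mem nV (eqmod_expMn sK nV (k * l) Kx KyV KV)).
apply: subgroupM => //; first by rewrite expgnA; apply: subgroupX.
by rewrite mulnC expgnA expVgn; apply: subgroupX => //; apply: subgroupV.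
Qed.

(** For [B] normal in [H], the preimage of the upper central series of [H/B]; index 0 is [B], index
    1 gives the centre of [H/B]. *)
Fixpoint upper_central H B (j : nat) : set G :=
  if j is i.+1
  then [set x | H x /\ forall h, H h -> upper_central H B i [~ x, h]]
  else B.

Lemma upper_central_normal H B j : subgroup H -> normal_in B H ->
  normal_in (upper_central H B j) H.
Proof.
move=> sH nB; elim: j => [//|j nU] /=; have sU := normal_subgroup nU.
set U := upper_central H B j in nU sU *.
have cM x y h : H x -> H y -> (forall h, H h -> U [~ x, h]) ->
    (forall h, H h -> U [~ y, h]) -> H h -> U [~ x * y, h].
  move=> Hx Hy Ux Uy Hh.
  have -> : [~ x * y, h] = [~ x, h] ^ y * [~ y, h].
    by rewrite !commgEl !conjgE !gnorm.
  by apply: subgroupM; [|apply: (normalJ sH)|]; auto.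
have cV x h : H x -> (forall h, H h -> U [~ x, h]) -> H h -> U [~ x^-1, h].
  move=> Hx Ux Hh.
  have -> : [~ x^-1, h] = [~ x, h]^-1 ^ x^-1.
    by rewrite !commgEl !conjgE !gnorm.
  by apply: (normalJ sH nU); [exact: subgroupV | apply: subgroupV; auto].
split.
- split=> [|x y [Hx Ux] [Hy Uy]].
    by split=> [|h _]; rewrite ?comm1g; apply: subgroup1.
  by split=> [|h Hh]; [apply: sH.2 | apply: cM => //; [exact: subgroupV|auto]].
- by move=> x [].
move=> g x Hg [Hx Ux]; rewrite innerE; split=> [|h Hh].
  by apply: subgroupJ => //; apply: subgroupV.
rewrite -[h](conjgK g) -conjRg; apply: (normalJ sH nU); first exact: subgroupV.
by apply: Ux; apply: subgroupJ.
Qed.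

Lemma upper_centralS H B j : subgroup H -> normal_in B H ->
  upper_central H B j `<=` upper_central H B j.+1.
Proof.
move=> sH nB x Ux; have nU := upper_central_normal j sH nB.
split=> [|h Hh]; first exact: (normal_sub nU).
exact: (normal_commr sH nU).
Qed.

Lemma lower_central_subgroup H j : subgroup H -> subgroup (lower_central H j).
Proof. by move=> sH; case: j => // j; apply: generated_subgroup. Qed.

Lemma lower_central_conj H K j : (forall g x, K g -> H x -> H (inner g x)) ->
  forall g x, K g -> lower_central H j x -> lower_central H j (inner g x).
Proof.
move=> nH g x Kg; elim: j x => [|j IHj] x /=; first exact: nH.
suff: lower_central H j.+1 `<=` [set x | lower_central H j.+1 (inner g x)]
  by apply.
have sC : subgroup (lower_central H j.+1) by apply: generated_subgroup.
apply: commutator_min => [|a b Ha Hb].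
  split=> [|a b /= Ca Cb]; first by rewrite /= innerE conj1g; apply: subgroup1.
  rewrite innerM !innerE conjVg -!innerE; exact: (sC.2).
rewrite /= innerE conjRg -!innerE; apply: commutator_sub;
  [exact: IHj|exact: nH].
Qed.

Lemma lower_central_normal H j : subgroup H -> normal_in (lower_central H j) H.
Proof.
move=> sH; have nH := normal_refl sH; split.
- exact: lower_central_subgroup.
- elim: j => [//|j IHj]; apply: commutator_min => // x y /IHj Hx Hy.
  exact: subgroupR.
- by move=> g x; apply: lower_central_conj => ? ?; apply: normal_inner nH.
Qed.

Lemma lower_central_dec H j : subgroup H ->
  lower_central H j.+1 `<=` lower_central H j.
Proof.
move=> sH; apply: commutator_min; first exact: lower_central_subgroup.
by move=> x y Hx Hy; apply: (normal_commr sH (lower_central_normal j sH)).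
Qed.

(** Commutation with [H] moves one step down the lower central series, which ends in [1], inside
    [B]; read backwards, this climbs the upper series modulo [B]. *)
Lemma lower_central_sub_upper H B c j : subgroup H -> normal_in B H ->
    lower_central H c = [set 1] -> (j <= c)%N ->
  lower_central H (c - j) `<=` upper_central H B j.
Proof.
move=> sH nB Hc; elim: j => [_|j IHj jc].
  by rewrite subn0 Hc => _ ->; apply: subgroup1; apply: normal_subgroup nB.
move=> x Hx; have nL := lower_central_normal (c - j.+1) sH.
split=> [|h Hh]; first exact: (normal_sub nL).
apply: IHj; first exact: ltnW.
by rewrite -(prednK (_ : 0 < c - j)%N) ?subn_gt0// -subnS;
  apply: commutator_sub.
Qed.

Lemma upper_central_full H B c : subgroup H -> normal_in B H ->
  lower_central H c = [set 1] -> H `<=` upper_central H B c.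
Proof.
move=> sH nB Hc x Hx; apply: (lower_central_sub_upper sH nB Hc) => //.
by rewrite subnn.
Qed.

(* If [x] is in the second centre modulo [B], then [x, h]^k = [x^k, h] modulo
   [B]; the general case descends along the upper central series. *)
Lemma upper_central1_isolated H B : subgroup H -> normal_in B H ->
  nilpotent H ->
    (forall x k, (0 < k)%N -> H x -> B (x ^+ k) -> B x) ->
  forall x k, (0 < k)%N -> H x -> upper_central H B 1 (x ^+ k) ->
    upper_central H B 1 x.
Proof.
move=> sH nB [c Hc] isoB x k k0 Hx; set U := upper_central H B.
have nU j : normal_in (U j) H by apply: upper_central_normal.
have step j y : U j.+1 y -> U j (y ^+ k) -> U j y.
  elim: j y => [|j IHj] y [Hy Uy]; first exact: isoB.
  move=> [_ Uyk]; split=> // h Hh; apply: IHj; first exact: Uy.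
  apply/(eqmod_mem (nU j) (eqmod_commX sH (nU j) k Hy Hh _)); last exact: Uyk.
  by move=> z Hz; apply: (Uy h Hh).2.
have desc j : U j.+1 x -> U 1%N (x ^+ k) -> U 1%N x.
  elim: j => [//|j IHj] Ux Uxk; apply: IHj => //; apply: step => //.
  elim: (j) => [//|i IHi]; exact: upper_centralS.
by apply: (desc c); apply: upper_centralS => //;
  apply: (upper_central_full _ _ Hc).
Qed.

(** For [B] normal in [T], the preimage of the lower central series of [T/B]. *)
Fixpoint relative_lower T B (i : nat) : set G :=
  if i is j.+1 then
    generated (B `|`
      [set x | exists a b, [/\ relative_lower T B j a, T b & x = [~ a, b]]])
  else T.

(* The subgroup [T] generated by the isolator is torsion modulo [B]: so is
   T / [T, T] B, and commutators of torsion elements are torsion modulo the next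
   term of the lower central series. *)
Lemma isolator_subgroup H B : subgroup H -> normal_in B H -> nilpotent H ->
  subgroup (isolator H B).
Proof.
move=> sH nB [c Hc]; have sB := normal_subgroup nB.
have BH := normal_sub nB.
pose T := generated (isolator H B); pose V := relative_lower T B.
have sT : subgroup T := generated_subgroup _.
have BT : B `<=` T by move=> x Bx; apply: sub_generated; apply: sub_isolator.
have TH : T `<=` H by apply: generated_min => // x [].
have sV i : subgroup (V i) by case: i => // i; apply: generated_subgroup.
have BV i : B `<=` V i.
  by case: i => // i x Bx; apply: sub_generated; left.
have commV i a b : V i a -> T b -> V i.+1 [~ a, b].
  by move=> Va Tb; apply: sub_generated; right; exists a, b.
have VT i : V i `<=` T.
  elim: i => // i IHi; apply: generated_min => // x [/BT//|[a [b [Va Tb ->]]]].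
  by apply: (subgroupR sT) => //; apply: IHi.
have nV i : normal_in (V i) T.
  elim: i => [|i IHi]; first exact: normal_refl.
  split=> // g x Tg Vx.
  suff: V i.+1 `<=` [set x | V i.+1 (inner g x)] by apply.
  apply: generated_min => [|y].
    split=> [|y z /= Vy Vz]; first by rewrite /= innerE conj1g;
      apply: subgroup1.
    by rewrite innerM !innerE conjVg -!innerE; apply: (sV i.+1).2.
  move=> [By|[a [b [Va Tb ->]]]] /=.
    by apply: BV; apply: (normal_inner nB) => //; apply: TH.
  rewrite innerE conjRg -!innerE; apply: commV; first exact: (normal_inner IHi).
  exact: (normal_inner (normal_refl sT)).
have Vdec i : V i.+1 `<=` V i.
  elim: i => [|i IHi]; apply: generated_min => // x.
    by move=> [/BT//|[a [b [Ta Tb ->]]]]; apply: (subgroupR sT).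
  by move=> [/BV//|[a [b [Va Tb ->]]]]; apply: commV => //; apply: IHi.
have torsV i : V i `<=` isolator (V i) (V i.+1).
  have sI j : subgroup (isolator (V j) (V j.+1)).
    apply: isolator_abelian => //; first exact: (normalS (nV _)).
    by move=> a b Va Vb; apply: commV => //; apply: VT Vb.
  elim: i => [|i IHi].
    apply: generated_min => // x [Hx [k k0 Bx]]; split.
      by apply: sub_generated; split=> //; exists k.
    by exists k => //; apply: BV.
  apply: generated_min => // x [Bx|[a [b [Va Tb ->]]]].
    by apply: sub_isolator => //; apply: BV.
  split; first exact: commV.
  have [_ [k k0 Vak]] := IHi a Va; exists k => //.
  have Ta := VT i a Va.
  have cen z : T z -> V i.+2 [~ [~ a, b], z].
    by move=> Tz; exact: commV (commV _ _ _ Va Tb) Tz.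
  apply/(eqmod_mem (nV i.+2) (eqmod_commX sT (nV i.+2) k Ta Tb cen)).
  exact: commV.
(* As [upper_central H B c] is all of [H], the series [V] has sunk into [B] after [c] steps, so
   torsion modulo [V c] is torsion modulo [B]. *)
have VU i : (i <= c)%N -> V i `<=` upper_central H B (c - i).
  have nU j : normal_in (upper_central H B j) H by apply: upper_central_normal.
  elim: i => [_|i IHi ic].
    by rewrite subn0 => x /TH; apply: upper_central_full.
  apply: generated_min; first exact: (normal_subgroup (nU _)).
  move=> x [Bx|[a [b [Va Tb ->]]]].
    by elim: (c - i.+1)%N => // j; apply: upper_centralS.
  have := IHi (ltnW ic) a Va.
  rewrite -(prednK (_ : 0 < c - i)%N) ?subn_gt0// -subnS => -[_]; apply.
  exact: TH.
have torsT i x : T x -> exists2 k, (0 < k)%N & V i (x ^+ k).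
  elim: i => [|i IHi] Tx; first by exists 1%N.
  have [k k0 /torsV[_ [l l0]]] := IHi Tx; rewrite -expgnA => Vx.
  by exists (k * l)%N; rewrite // muln_gt0 k0.
suff -> : isolator H B = T by [].
apply/seteqP; split=> [|x Tx]; first exact: sub_generated.
split; first exact: TH.
have [k k0 /(VU c (leqnn _))] := torsT c x Tx; rewrite subnn => Bx.
by exists k.
Qed.

End Subgroups.

(** * Subgroups of Z^n *)

(** Euclidean division by the least positive element; [d = 0] if there is none. *)
Lemma int_subgroup_gen (S : set int) :
    S 0 -> (forall x y, S x -> S y -> S (x - y)) ->
  exists2 d, S d & forall x, S x -> (d %| x)%Z.
Proof.
move=> S0 SB; have SN x : S x -> S (- x) by rewrite -sub0r; apply: SB.
have [[n [n0 Sn]]|noS] := pselect (exists n : nat, (0 < n)%N /\ S n%:Z);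
  last first.
  exists 0 => // x Sx; rewrite dvd0z; apply/negPn/negP => x0; apply: noS.
  exists `|x|%N; rewrite absz_gt0; split=> //.
  by case: (intP x) Sx => [|m|m] //; rewrite ?abszN //; move=> /SN;
    rewrite opprK.
have exd : exists n, (0 < n)%N && `[< S n%:Z >].
  by exists n; rewrite n0; apply/asboolP.
case: (ex_minnP exd) => d /andP[d0 /asboolP Sd] dmin.
exists d%:Z => // x Sx; have SM k : S (k *~ d%:Z).
  have SMn m : S (d%:Z *+ m).
    elim: m => [//|m IHm]; rewrite mulrSr -[X in _ + X]opprK.
    by apply: SB => //; apply: SN.
  rewrite mulrzz mulrC -mulrzz; case: k => m; first exact: SMn.
  by apply: SN; apply: SMn.
have d_neq0 : d%:Z != 0 by rewrite eqz_nat -lt0n.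
apply/dvdz_mod0P; have Sr : S (x %% d%:Z)%Z.
  by rewrite /modz -mulrzz; apply: SB.
have r0 := modz_ge0 x d_neq0; have rd : (x %% d%:Z)%Z < d%:Z by apply: ltz_pmod.
move: r0 rd Sr; case: (x %% d%:Z)%Z => [m|//] _; rewrite ltz_nat => md Sm.
apply/eqP; rewrite eqz_nat -leqn0 leqNgt; apply/negP => m0.
by move: md; rewrite ltnNge dmin// m0; apply/asboolP.
Qed.

Definition Zspan k (L : set 'rV[int]_k) :=
  L 0 /\ forall x y, L x -> L y -> L (x - y).

Definition has_basis k (L : set 'rV[int]_k) :=
  exists r (M : 'M[int]_(r, k)), (forall v : 'rV_r, v *m M = 0 -> v = 0) /\
    forall x, L x <-> exists v, x = v *m M.

(** The first coordinates of [L] form [d Z]. The vectors of [L] with first coordinate 0 have a basis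
    by hypothesis; if [d] is nonzero, a vector [l] of [L] over [d] is added to it. The size is
    written [1 + k] for the block operations. *)
Lemma has_basis_step k : (forall L, Zspan L -> @has_basis k L) ->
  forall L, Zspan L -> @has_basis (1 + k) L.
Proof.
move=> IHk L [L0 LB].
have LN x : L x -> L (- x) by rewrite -sub0r; apply: LB.
have LD x y : L x -> L y -> L (x + y).
  by move=> Lx /LN /(LB _ _ Lx); rewrite opprK.
have LZ x (z : int) : L x -> L (z *: x).
  move=> Lx; rewrite -[z]intz scaler_int.
  have LM m : L (x *+ m) by elim: m => [//|m IHm]; rewrite mulrS; apply: LD.
  by case: z => m; [apply: LM | apply: LN; apply: LM].
pose i0 : 'I_(1 + k) := lshift k ord0; pose x0 (x : 'rV[int]_(1 + k)) := x 0 i0.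
have [d [l Ll ld] dmin] : exists2 d, (x0 @` L) d &
    forall z, (x0 @` L) z -> (d %| z)%Z.
  apply: int_subgroup_gen; first by exists 0; rewrite /x0 ?mxE.
  by move=> _ _ [x Lx <-] [y Ly <-]; exists (x - y); rewrite /x0 ?mxE//;
    apply: LB.
pose L' := [set y : 'rV[int]_k | L (row_mx (0 : 'rV_1) y)].
have spanL' : Zspan L'.
  split=> [|x y Lx Ly]; first by rewrite /L' /= row_mx0.
  by rewrite /L' /= -[X in row_mx X _]subr0 -add_row_mx -opp_row_mx; apply: LB.
have [r [M' [M'free M'P]]] := IHk L' spanL'.
have x0_row (y : 'rV_k) : x0 (row_mx 0 y) = 0 by rewrite /x0 row_mxEl mxE.
have tailE (x : 'rV[int]_(1 + k)) : x0 x = 0 -> x = row_mx 0 (rsubmx x).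
  move=> xx0; rewrite -[LHS]hsubmxK; congr row_mx; apply/rowP => i.
  by rewrite ord1 !mxE -xx0.
have [d0|d_neq0] := eqVneq d 0.
  exists r, (row_mx 0 M'); split=> [v|x].
    by rewrite mul_mx_row -[X in _ = X]row_mx0 => /eq_row_mx[_ /M'free].
  split=> [Lx|[v ->]]; last first.
    by rewrite mul_mx_row mulmx0; apply/M'P; exists v.
  have xx0 : x0 x = 0.
    by apply/eqP; rewrite -dvd0z -d0; apply: dmin; exists x.
  have /M'P[v vE] : L' (rsubmx x) by rewrite /L' /= -tailE.
  by exists v; rewrite mul_mx_row mulmx0 -vE; apply: tailE.
exists (1 + r)%N, (col_mx l (row_mx 0 M')).
have mulE (v : 'rV[int]_(1 + r)) : v *m col_mx l (row_mx 0 M') =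
    lsubmx v 0 0 *: l + row_mx 0 (rsubmx v *m M').
  rewrite -{1}[v]hsubmxK mul_row_col mul_mx_row mulmx0.
  by rewrite {1}[lsubmx v]mx11_scalar mul_scalar_mx.
have x0E a y : x0 (a *: l + row_mx 0 y) = a * d.
  rewrite /x0 [LHS]mxE -/(x0 (row_mx 0 y)) x0_row addr0 [LHS]mxE.
  by rewrite -ld.
split=> [v|x].
  rewrite mulE => v0.
  have a0 : lsubmx v 0 0 = 0.
    have /eqP := congr1 x0 v0.
    by rewrite x0E [x0 0]mxE mulf_eq0 (negPf d_neq0) orbF => /eqP.
  move: v0; rewrite a0 scale0r add0r -[X in _ = X]row_mx0.
  move=> /eq_row_mx[_ /M'free v0];
    rewrite -[v]hsubmxK v0 [lsubmx v]mx11_scalar a0.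
  by rewrite raddf0 row_mx0.
split=> [Lx|[v ->]]; last first.
  rewrite mulE; apply: LD; first exact: LZ.
  by apply/M'P; exists (rsubmx v).
have /dvdzP[z xz] : (d %| x0 x)%Z by apply: dmin; exists x.
have xlE : x - z *: l = row_mx 0 (rsubmx (x - z *: l)).
  by apply: tailE; rewrite /x0 !mxE -/(x0 x) -/(x0 l) xz ld subrr.
have /M'P[v vE] : L' (rsubmx (x - z *: l)).
  by rewrite /L' /= -xlE; apply: LB => //; apply: LZ.
exists (row_mx z%:M v); rewrite mulE row_mxKl row_mxKr !mxE eqxx mulr1n.
by rewrite -vE -xlE addrC subrK.
Qed.

Lemma sublattice_basis k (L : set 'rV[int]_k) : Zspan L -> has_basis L.
Proof.
elim: k L => [|k IHk] L spanL; last exact: (has_basis_step IHk).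
have [L0 _] := spanL.
exists 0%N, 0; split=> [v _|x]; first by rewrite thinmx0.
by rewrite [x]thinmx0; split=> // _; exists 0; rewrite !thinmx0.
Qed.

(** * Torsion-free abelian sections of polycyclic groups *)

Section Zquotients.
Variable G : groupType.
Implicit Types (A B H K N S V P : set G) (x y g h : G).
Local Open Scope group_scope.

Definition zexp x (z : int) : G :=
  match z with Posz n => x ^+ n | Negz n => x ^- n.+1 end.

Lemma zexpS x (z : int) : zexp x (z + 1)%R = x * zexp x z.
Proof.
case: z => [n|[|n]]; first by rewrite -PoszD addn1 /= expgS.
  by rewrite /= mulgV.
have -> : (Negz n.+1 + 1 = Negz n)%R.
  by rewrite !NegzE -[n.+2]addn1 PoszD opprD addrK.
by rewrite /= [in RHS]expgSr invgM mulVKg.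
Qed.

Lemma zexpD x (y z : int) : zexp x (y + z)%R = zexp x y * zexp x z.
Proof.
have zexpP t : zexp x (t - 1)%R = x^-1 * zexp x t.
  by rewrite -{2}[t](subrK 1%R) zexpS mulKg.
elim/int_ind: y => [|n IHn|n IHn]; first by rewrite add0r mul1g.
  by rewrite intS -addrA addrC zexpS IHn mulgA -zexpS addrC.
by rewrite intS opprD -addrA addrC zexpP IHn mulgA -zexpP addrC.
Qed.

Lemma zexpN x z : zexp x (- z)%R = (zexp x z)^-1.
Proof.
apply: (mulIg (zexp x z)); rewrite mulVg -zexpD addNr.
by [].
Qed.

Lemma subgroup_zexp A x z : subgroup A -> A x -> A (zexp x z).
Proof.
move=> sA Ax; case: z => n /=; first exact: subgroupX.
by apply: subgroupV => //; apply: subgroupX.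
Qed.

(** A relation and not a function, since [z] is not unique when [g] has finite order modulo [B]. *)
Definition exponent_mod B g (z : int) x := B ((zexp g z)^-1 * x).

Lemma exponent_mod1 B g : subgroup B -> exponent_mod B g 0%R 1.
Proof.
by move=> sB; rewrite /exponent_mod /= invg1 mulg1; apply: subgroup1.
Qed.

Lemma exponent_modF A B g z t x y : subgroup A -> normal_in B A -> A g ->
  exponent_mod B g z x -> exponent_mod B g t y ->
  exponent_mod B g (z - t)%R (x * y^-1).
Proof.
move=> sA nB Ag; rewrite /exponent_mod zexpD zexpN.
set a := zexp g z; set b := zexp g t => Bx By.
have -> : (a * b^-1)^-1 * (x * y^-1) = inner b ((a^-1 * x) * (b^-1 * y)^-1).
  by rewrite /inner !gnorm.
apply: (normal_inner nB); first exact: subgroup_zexp.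
exact: (normal_subgroup nB).2.
Qed.

Lemma exponent_mod_zexp A B g z x k : subgroup A -> normal_in B A -> A g ->
  exponent_mod B g z x -> exponent_mod B g (z * k)%R (zexp x k).
Proof.
move=> sA nB Ag Ezx; have EF := @exponent_modF _ _ _ _ _ _ _ sA nB Ag.
have E1 := exponent_mod1 g (normal_subgroup nB).
have EN t y : exponent_mod B g t y -> exponent_mod B g (- t)%R y^-1.
  by move=> Ety; rewrite -[(- t)%R]sub0r -[y^-1]mul1g; apply: EF.
have EX n : exponent_mod B g (z * n%:Z)%R (x ^+ n).
  elim: n => [|n IHn]; first by rewrite mulr0.
  rewrite expgS intS mulrDr mulr1 -[x ^+ n]invgK -[(z * n)%R]opprK.
  by apply: EF => //; apply: EN.
by case: k => n; [apply: EX | rewrite NegzE mulrN; apply/EN/EX].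
Qed.

Lemma cyclic_extension A B g : subgroup A -> normal_in B A ->
  A = generated (B `|` [set g]) ->
  forall x, A x -> exists z, exponent_mod B g z x.
Proof.
move=> sA nB AE; have Ag : A g by rewrite AE; apply: sub_generated; right.
have sB := normal_subgroup nB; rewrite [X in forall x, X x -> _]AE.
apply: generated_min => [|x].
  split=> [|x y [z Ex] [t Ey]]; first by exists 0%R; apply: exponent_mod1.
  by exists (z - t)%R; apply: (exponent_modF sA nB).
move=> [Bx|->]; rewrite /exponent_mod.
  by exists 0%R; rewrite /= invg1 mul1g.
by exists 1%R; rewrite /= mulVg; apply: subgroup1.
Qed.

(** The exponents of the elements of [A] form a subgroup [d Z] of the integers; an [h] in [A] with
    exponent [d] generates [A] modulo [P1]. *)
Lemma cyclic_extension_sub P P1 g A : subgroup P -> normal_in P1 P ->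
    P = generated (P1 `|` [set g]) -> subgroup A -> A `<=` P ->
  exists2 h, A h & forall x, A x -> exists z, exponent_mod (A `&` P1) h z x.
Proof.
move=> sP nP1 PE sA AP.
have Pg : P g by rewrite PE; apply: sub_generated; right.
have sP1 := normal_subgroup nP1.
have [d [h [Ah Eh]] dP] := int_subgroup_gen
  (S := [set z | exists x, A x /\ exponent_mod P1 g z x])
  (ex_intro _ 1 (conj (subgroup1 sA) (exponent_mod1 g sP1)))
  (fun z t '(ex_intro x (conj Ax Ex)) '(ex_intro y (conj Ay Ey)) =>
    ex_intro _ _ (conj (sA.2 x y Ax Ay) (exponent_modF sP nP1 Pg Ex Ey))).
exists h => // x Ax; have [z Ez] := cyclic_extension sP nP1 PE (AP _ Ax).
have /dvdzP[k zE] : (d %| z)%Z by apply: dP; exists x.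
exists k; have Ahk := subgroup_zexp k sA Ah; split.
  by apply: subgroupM => //; apply: subgroupV.
have := exponent_modF sP nP1 Pg Ez (exponent_mod_zexp k sP nP1 Pg Eh).
rewrite zE mulrC subrr /exponent_mod /= invg1 mul1g => P1x.
(* The element [x h^-k] has exponent 0; a conjugation moves [h^-k] to the left, as [exponent_mod]
   requires. *)
rewrite -[X in P1 X](_ : inner (zexp h k)^-1 (x * (zexp h k)^-1) = _);
  last first.
  by rewrite /inner !gnorm.
by apply: (normal_inner nP1) => //; apply: AP; apply: subgroupV.
Qed.

(** This is [Zn_quotient] without surjectivity, which need not survive the induction along a
    polycyclic series and is restored at the end by a basis of the image. *)
Definition Zn_embedding A B k (q : G -> 'rV[int]_k) :=
  (forall x y, A x -> A y -> q (x * y) = (q x + q y)%R) /\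
  (forall x, A x -> q x = 0%R <-> B x).

Lemma embeddingV A B k (q : G -> 'rV[int]_k) x : subgroup A ->
  Zn_embedding A B q -> A x -> q x^-1 = (- q x)%R.
Proof.
move=> sA [qM _] Ax; have A1 := subgroup1 sA; have Ax' := subgroupV sA Ax.
have q1 : q 1 = 0%R by apply: (addrI (q 1)); rewrite -qM// mulg1 addr0.
by apply/eqP; rewrite -addr_eq0 -qM// mulVg q1.
Qed.

Lemma embedding_eq A B k (q : G -> 'rV[int]_k) x y : subgroup A ->
  Zn_embedding A B q -> A x -> A y -> q x = q y <-> eqmod B x y.
Proof.
move=> sA qE Ax Ay; have [qM qB] := qE; have Ay' := subgroupV sA Ay.
rewrite /eqmod -qB; last exact: subgroupM.
rewrite qM// (embeddingV sA qE)//; split=> [->|/eqP]; first by rewrite subrr.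
by rewrite subr_eq0 => /eqP.
Qed.

Lemma Zn_embedding_step A A1 B h k1 (q1 : G -> 'rV[int]_k1) : subgroup A ->
    normal_in A1 A -> A h ->
    (forall x, A x -> exists z, exponent_mod A1 h z x) ->
    normal_in B A -> (forall x y, A x -> A y -> B [~ x, y]) ->
    (forall x e, (0 < e)%N -> A x -> B (x ^+ e) -> B x) ->
    Zn_embedding A1 (A1 `&` B) q1 ->
  exists k (q : G -> 'rV[int]_k), Zn_embedding A B q.
Proof.
move=> sA nA1 Ah hA nB AB isoB q1E; have sA1 := normal_subgroup nA1.
have sB := normal_subgroup nB; have A1A := normal_sub nA1.
have q1P x y : A1 x -> A1 y -> eqmod B x y -> q1 x = q1 y.
  move=> A1x A1y Bxy; apply/(embedding_eq sA1 q1E) => //; split=> //.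
  exact: sA1.2.
have M := eqmodM nB; have trans := @eqmod_trans _ _ _ nB.
have refl := eqmod_refl nB; have sym := @eqmod_sym _ _ _ nB.
have VM x s : A x -> A s -> eqmod B x s -> eqmod B x^-1 s^-1.
  move=> Ax As Bxs; rewrite /eqmod invgK -[x^-1 * s]invgK invgM invgK.
  apply: subgroupV => //.
  have -> : s^-1 * x = inner s^-1 (x * s^-1) by rewrite /inner !gnorm.
  by apply: (normal_inner nB) => //; apply: subgroupV.
(* If [h ^+ e] falls in [A1 B], then [x |-> x ^+ e] embeds A/B into
   A1/(A1 & B); otherwise A/B is the direct product of <h> and A1/(A1 & B). *)
have [[e [u [e0 A1u hu]]]|noe] := pselect (exists e u,
    [/\ (0 < e)%N, A1 u & eqmod B (h ^+ e) u]).
  pose S := [set x | A x /\ exists2 s, A1 s & eqmod B (x ^+ e) s].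
  have XM x y : A x -> A y -> eqmod B ((x * y) ^+ e) (x ^+ e * y ^+ e).
    by move=> Ax Ay; apply: (eqmod_expMn sA nB).
  have sS : subgroup S.
    split=> [|x y [Ax [s A1s xs]] [Ay [t A1t yt]]].
      split; [exact: subgroup1 | exists 1; first exact: subgroup1].
      by rewrite expg1n; apply: refl.
    split; first exact: sA.2.
    exists (s * t^-1); first exact: sA1.2.
    apply: (trans _ _ _ (XM _ _ Ax (subgroupV sA Ay))).
    rewrite expVgn; apply: (eqmodM nB) => //; first exact: subgroupX.
    by apply: VM => //; [exact: subgroupX | exact: A1A].
  have AS x : A x -> S x.
    move=> Ax; have [z Ez] := hA x Ax; rewrite -[x](mulVKg (zexp h z)).
    apply: subgroupM => //.
      by apply: subgroup_zexp => //; split=> //; exists u.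
    split; first exact: A1A.
    by exists (((zexp h z)^-1 * x) ^+ e); [apply: subgroupX | apply: refl].
  have /choice[s sP] : forall x, exists s, A x -> A1 s /\ eqmod B (x ^+ e) s.
    move=> x; have [/AS[_ [s A1s xs]]|nAx] := pselect (A x); last by exists 1.
    by exists s.
  exists k1, (q1 \o s); split=> [x y Ax Ay|x Ax] /=.
    have [[A1x xs] [A1y ys]] := (sP x Ax, sP y Ay).
    have [A1xy xys] := sP _ (subgroupM sA Ax Ay).
    rewrite -q1E.1//; apply: q1P => //; first exact: subgroupM.
    apply: (trans _ _ _ (sym _ _ xys)); apply: (trans _ _ _ (XM _ _ Ax Ay)).
    by apply: (eqmodM nB) => //; apply: subgroupX.
  have [A1x xs] := sP x Ax; rewrite q1E.2//; split=> [[_ Bs]|Bx].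
    by apply: (isoB x e) => //; apply/(eqmod_mem nB xs).
  by split=> //; apply/(eqmod_mem nB xs); apply: subgroupX.
(* For [z] different from [t], a positive power of [h] would be congruent to an element of [A1],
   against [noe]. *)
have uniq z t u v : A1 u -> A1 v -> eqmod B (zexp h z * u) (zexp h t * v) ->
    z = t /\ eqmod B u v.
  move=> A1u A1v zutv.
  have Az w : A (zexp h w) by apply: subgroup_zexp.
  have [Au Av] := (A1A _ A1u, A1A _ A1v).
  have zt : eqmod B (zexp h (z - t)%R) (v * u^-1).
    have : eqmod B ((zexp h t)^-1 * (zexp h z * u) * u^-1)
                   ((zexp h t)^-1 * (zexp h t * v) * u^-1).
      apply: (eqmodM nB); [|apply: (eqmodM nB) => //|exact: refl].
        by do 3?[apply: subgroupM => //]; apply: subgroupV.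
        by apply: subgroupV.
    by rewrite mulKg mulgA mulgK -zexpN -zexpD addrC.
  have zt0 : (z - t = 0)%R.
    have A1vu : A1 (v * u^-1) by apply: sA1.2.
    case: (z - t)%R zt => [[//|n]|n] /= hvu; case: noe.
      by exists n.+1, (v * u^-1).
    exists n.+1, (v * u^-1)^-1; split=> //; first exact: subgroupV.
    rewrite -[h ^+ n.+1]invgK; apply: VM => //; last exact: A1A.
    by apply: subgroupV => //; apply: subgroupX.
  move: zutv; rewrite (subr0_eq zt0) => zutv; split=> //.
  rewrite /eqmod -[u](mulKg (zexp h t)) -[v](mulKg (zexp h t)).
  by apply: (M ((zexp h t)^-1)) => //; apply: subgroupV.
have /choice[f fP] : forall x, exists p : int * G,
    A x -> A1 p.2 /\ eqmod B x (zexp h p.1 * p.2).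
  move=> x; have [Ax|nAx] := pselect (A x); last by exists (0%R, 1).
  have [z Ez] := hA x Ax; exists (z, (zexp h z)^-1 * x) => _; split=> //=.
  by rewrite mulVKg; apply: refl.
have Az w : A (zexp h w) by apply: subgroup_zexp.
exists (1 + k1)%N, (fun x => row_mx ((f x).1%:M : 'M_1) (q1 (f x).2)).
split=> [x y Ax Ay|x Ax].
  have [[A1x xf] [A1y yf]] := (fP x Ax, fP y Ay).
  have [A1xy xyf] := fP _ (subgroupM sA Ax Ay).
  have [z1E s1E] : (f (x * y)).1 = ((f x).1 + (f y).1)%R /\
      eqmod B (f (x * y)).2 ((f x).2 * (f y).2).
    apply: uniq => //; first exact: subgroupM.
    apply: (trans _ _ _ (sym _ _ xyf)).
    apply: (trans _ _ _ (M _ _ _ _ Ax xf yf)).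
    rewrite zexpD -!mulgA; apply: (eqmodM nB); [exact: Az|exact: refl|].
    rewrite !mulgA; apply: (eqmodM nB); [| |exact: refl].
      by apply: subgroupM => //; exact: A1A.
    by apply: (eqmodC sA nB); [exact: A1A| |apply: AB => //; exact: A1A].
  rewrite add_row_mx z1E raddfD /=; congr row_mx.
  by rewrite -q1E.1//; apply: q1P => //; apply: subgroupM.
have [A1x xf] := fP x Ax; split=> [|Bx].
  rewrite -[X in _ = X]row_mx0 => /eq_row_mx[/matrixP/(_ 0%R 0%R)].
  rewrite !mxE mulr1n => z0 /q1E.2[//|_ Bf].
  by apply/(eqmod_mem nB xf); rewrite z0 mul1g.
have [z0 f1] : (f x).1 = 0%R /\ eqmod B (f x).2 1.
  apply: uniq => //; first exact: subgroup1.
  apply: (trans _ _ _ (sym _ _ xf)).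
  by rewrite /eqmod /= mulg1 invg1 mulg1.
have -> : q1 (f x).2 = 0%R.
  by apply/q1E.2 => //; split=> //; move: f1; rewrite /eqmod invg1 mulg1.
by rewrite z0 raddf0 row_mx0.
Qed.

(** Induction on the length of the series of [P]: [A] and [B] are intersected with [P_ 1], modulo
    which [A] is generated by one element. *)
Lemma Zn_embedding_polycyclic P A B : polycyclic P -> subgroup A -> A `<=` P ->
    normal_in B A -> (forall x y, A x -> A y -> B [~ x, y]) ->
    (forall x e, (0 < e)%N -> A x -> B (x ^+ e) -> B x) ->
  exists k (q : G -> 'rV[int]_k), Zn_embedding A B q.
Proof.
move=> [n [P_ [sP P0 Pn Pstep]]]; have {sP} : subgroup (P_ 0%N) by rewrite P0.
rewrite -{}P0; elim: n P_ Pn Pstep A B =>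
  [|n IHn] P_ Pn Pstep A B sP sA AP nB AB isoB.
  exists 0%N, (fun=> 0%R); split=> [x y _ _|x /AP]; first by rewrite addr0.
  by rewrite Pn => ->; split=> // _; apply: subgroup1;
    apply: normal_subgroup nB.
have [nP1 [g PE]] := Pstep 0%N isT; have sP1 := normal_subgroup nP1.
have [h Ah hA] := cyclic_extension_sub sP nP1 PE sA AP.
have sA1 := subgroupI sA sP1.
have nA1 : normal_in (A `&` P_ 1%N) A.
  split=> // a b Aa [Ab P1b]; split.
    by apply: (normal_inner (normal_refl sA)).
  by apply: (normal_inner nP1) => //; apply: AP.
have Pstep' i : (i < n)%N -> normal_in (P_ i.+2) (P_ i.+1) /\
    exists g, P_ i.+1 = generated (P_ i.+2 `|` [set g]) by move=> /(Pstep i.+1).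
have [||||||k1 [q1 q1E]] :=
    IHn (fun i => P_ i.+1) Pn Pstep' (A `&` P_ 1%N) (A `&` P_ 1%N `&` B).
- exact: sP1.
- exact: sA1.
- by move=> x [].
- split; first by apply: subgroupI => //; exact: normal_subgroup nB.
    by move=> x [].
  move=> a b A1a [A1b Bb]; split.
    by apply: (normal_inner (normal_refl sA1)).
  by apply: (normal_inner nB) => //; case: A1a.
- move=> x y A1x A1y; split; first exact: subgroupR.
  by apply: AB; [case: A1x|case: A1y].
- by move=> x e e0 A1x [_ Bx]; split=> //; apply: (isoB x e) => //; case: A1x.
exact: (Zn_embedding_step sA nA1 Ah hA nB AB isoB q1E).
Qed.

(** The image of an embedding is a sublattice, and coordinates in a basis of it give a
    surjection. *)
Lemma Zn_quotient_exists P A B : polycyclic P -> subgroup A -> A `<=` P ->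
    normal_in B A -> (forall x y, A x -> A y -> B [~ x, y]) ->
    (forall x e, (0 < e)%N -> A x -> B (x ^+ e) -> B x) ->
  exists n (q : G -> 'rV[int]_n), Zn_quotient A B q.
Proof.
move=> pP sA AP nB AB isoB.
have [k [q qE]] := Zn_embedding_polycyclic pP sA AP nB AB isoB.
have spanA : Zspan (q @` A).
  split=> [|_ _ [x Ax <-] [y Ay <-]].
    exists 1; first exact: subgroup1.
    by apply/qE.2; apply: subgroup1 => //; apply: normal_subgroup nB.
  exists (x * y^-1); first exact: sA.2.
  by rewrite qE.1//; [rewrite (embeddingV sA qE) | apply: subgroupV].
have [r [M [Mfree MP]]] := sublattice_basis spanA.
have /choice[q' q'P] : forall x, exists v, A x -> q x = (v *m M)%R.
  move=> x; have [Ax|nAx] := pselect (A x); last by exists 0%R.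
  by have /MP[v vE] : (q @` A) (q x); [exists x | exists v].
have Minj (v w : 'rV[int]_r) : (v *m M = w *m M)%R -> v = w.
  by move=> vw; apply/subr0_eq/Mfree; rewrite mulmxBl vw subrr.
exists r, q'; split=> [x y Ax Ay|v||x Ax].
- apply: Minj; rewrite -q'P; last exact: subgroupM.
  by rewrite qE.1// mulmxDl -!q'P.
- have [x Ax qx] : (q @` A) (v *m M)%R by apply/MP; exists v.
  by exists x => //; apply: Minj; rewrite -q'P.
- exact: normal_sub nB.
rewrite -(qE.2 x Ax) q'P//; split=> [->|/Mfree//]; exact: mul0mx.
Qed.

End Zquotients.

(** * The filtration of an NR-group *)

Lemma additive_int_mx m n (g : 'rV[int]_m -> 'rV[int]_n) :
  (forall v w, g (v + w) = g v + g w) ->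
  exists M : 'M[int]_(m, n), forall v, g v = v *m M.
Proof.
move=> gD; have g0 : g 0 = 0 by apply: (addrI (g 0)); rewrite -gD !addr0.
have gN v : g (- v) = - g v.
  by apply/eqP; rewrite -addr_eq0 -gD addNr g0.
have gZ (z : int) v : g (z *: v) = z *: g v.
  rewrite -[z]intz !scaler_int.
  have gM k : g (v *+ k) = g v *+ k.
    by elim: k => [//|k IHk]; rewrite !mulrS gD IHk.
  by case: z => k; rewrite /intmul ?gN gM.
exists (\matrix_i g (delta_mx 0 i)) => v.
rewrite {1}[v]row_sum_delta (big_morph g gD g0) mulmx_sum_row.
by apply: eq_bigr => i _; rewrite gZ rowK.
Qed.

Section NR.
Variable G : groupType.
Implicit Types (A B D H K N S V P : set G) (x y g h : G) (f : G -> G).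

Lemma Zn_quotient_embedding A B n (q : G -> 'rV[int]_n) :
  Zn_quotient A B q -> Zn_embedding A B q.
Proof. by case. Qed.

(** [f] descends to [A/B] because it preserves [B]; hence, for chosen preimages [s v], the map
    [v |-> q (f (s v))] is additive. *)
Lemma induced_mx_exists A B n (q : G -> 'rV[int]_n) f : subgroup A ->
    Zn_quotient A B q ->
    (forall x y, A x -> A y -> f (x * y)%g = (f x * f y)%g) ->
    (forall x, A x -> A (f x)) -> (forall x, B x -> B (f x)) ->
  exists M, induced_mx f A q M.
Proof.
move=> sA qq fM fA fB; have [qM qsurj BA qB] := qq.
have qE := Zn_quotient_embedding qq; have qeq := embedding_eq sA qE.
have f1 : f 1%g = 1%g.
  by apply: (mulgI (f 1%g)); rewrite -fM ?mulg1//; apply: subgroup1.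
have fV x : A x -> f x^-1%g = (f x)^-1%g.
  move=> Ax; apply: (mulgI (f x)); rewrite -fM ?mulgV//; exact: subgroupV.
have fq x y : A x -> A y -> q x = q y -> q (f x) = q (f y).
  move=> Ax Ay /qeq-/(_ Ax Ay) Bxy; apply/qeq; try exact: fA.
  rewrite /eqmod -fV// -fM//; first exact: fB.
  exact: subgroupV.
have /choice[s sP] : forall v, exists x, A x /\ q x = v.
  by move=> v; have [x Ax qx] := qsurj v; exists x.
have [M ME] : exists M : 'M[int]_n, forall v, q (f (s v)) = v *m M.
  apply: additive_int_mx => v w; have [[Av qv] [Aw qw]] := (sP v, sP w).
  rewrite -qM; try exact: fA.
  rewrite -fM//; apply: fq; [exact: (sP _).1 | exact: subgroupM |].
  by rewrite qM// qv qw (sP _).2.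
exists M => x Ax; rewrite -ME; have [As qs] := sP (q x).
by apply: fq.
Qed.

Lemma commutator_normal D : subgroup D -> normal_in (commutator_subgroup D D) D.
Proof. exact: (@lower_central_normal _ D 1%N). Qed.

Lemma root_commutator_subgroup D : subgroup D -> subgroup (root_commutator D).
Proof.
move=> sD; apply: isolator_abelian => //; first exact: commutator_normal.
by move=> a b; apply: commutator_sub.
Qed.

Lemma root_commutator_normal D : subgroup D -> normal_in (root_commutator D) D.
Proof.
move=> sD; split; [exact: root_commutator_subgroup | exact: isolator_sub |].
apply: isolator_conj => g x Dg.
  exact: (normal_inner (normal_refl sD)).
exact: (normal_inner (commutator_normal sD)).
Qed.

Lemma commutator_subgroupS A B A' B' : A `<=` A' -> B `<=` B' ->
  commutator_subgroup A B `<=` commutator_subgroup A' B'.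
Proof.
move=> AA' BB'; apply: generatedS => _ [a [b [Aa Bb ->]]].
by exists a, b; split; [apply: AA' | apply: BB' |].
Qed.

Lemma root_commutatorS D N : D `<=` N ->
  root_commutator D `<=` root_commutator N.
Proof.
move=> DN x [Dx [k k0 Cx]]; split; first exact: DN.
by exists k => //; apply: commutator_subgroupS Cx.
Qed.

Lemma lower_centralS H K i : H `<=` K ->
  lower_central H i `<=` lower_central K i.
Proof.
by move=> HK; elim: i => [//|i IHi]; apply: commutator_subgroupS.
Qed.

Lemma nilpotent_sub H K : subgroup H -> H `<=` K -> nilpotent K -> nilpotent H.
Proof.
move=> sH HK [c Kc]; exists c; apply/seteqP;
  split=> [x /(lower_centralS HK)|_ ->].
  by rewrite Kc.
by apply: subgroup1; apply: lower_central_subgroup.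
Qed.

(** [N/K] is abelian and torsion-free, so a root of a product of commutators is sent to 0. *)
Lemma root_commutator_sub_kernel N K n (q : G -> 'rV[int]_n) : subgroup N ->
  Zn_quotient N K q -> root_commutator N `<=` K.
Proof.
move=> sN qq; have qE := Zn_quotient_embedding qq; have [qM _ _ qK] := qq.
have q1 : q 1%g = 0.
  by apply: (addrI (q 1%g)); rewrite -qM ?mulg1 ?addr0//; apply: subgroup1.
have sK : subgroup K.
  split=> [|x y Kx Ky]; first by apply/qK => //; apply: subgroup1.
  have [Nx Ny] : N x /\ N y by case: qq => _ _ KN _; split; apply: KN.
  have Ny' := subgroupV sN Ny.
  apply/qK; first exact: sN.2.
  rewrite qM// (embeddingV sN qE)//.
  have [-> ->] : q x = 0 /\ q y = 0 by split; apply/qK.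
  by rewrite subrr.
move=> x [Nx [k k0 Cx]]; apply/qK => //.
have qX m : q (x ^+ m)%g = q x *+ m.
  elim: m => [//|m IHm]; rewrite expgS mulrS qM ?IHm//; exact: subgroupX.
have : K (x ^+ k)%g.
  move: Cx; apply: commutator_min => // a b Na Nb; apply/qK.
    exact: subgroupR.
  have [Na' Nb'] := (subgroupV sN Na, subgroupV sN Nb).
  have Nab := subgroupM sN Na Nb; have Nbab := subgroupM sN Nb' Nab.
  rewrite commgEl conjgE qM// qM// qM// !(embeddingV sN qE)//.
  by rewrite addrA -opprD addNr.
move=> /qK-/(_ (subgroupX _ sN Nx)); rewrite qX -scaler_nat => /rowP qk0.
apply/rowP => i; have := qk0 i; rewrite !mxE => /eqP.
by rewrite mulf_eq0 pnatr_eq0 eqn0Ngt k0 => /eqP.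
Qed.

Lemma nilpotency_classP A : nilpotent A ->
  lower_central A (nilpotency_class A) = [set 1%g].
Proof.
move=> [c Ac]; rewrite /nilpotency_class; case: xgetP => [? _ []//|noc].
have exc : exists c, `[< lower_central A c = [set 1%g] >].
  by exists c; apply/asboolP.
case: (ex_minnP exc) => m /asboolP Am mmin; case: (noc m); split=> // k km Ak.
by move: km; rewrite ltnNge mmin//; apply/asboolP.
Qed.

Lemma isolator_morph f A B : (forall x y, f (x * y)%g = (f x * f y)%g) ->
    (forall x, A x -> A (f x)) -> (forall x, B x -> B (f x)) ->
  forall x, isolator A B x -> isolator A B (f x).
Proof.
move=> fM fA fB x [Ax [k k0 Bx]]; split; first exact: fA.
exists k => //; have f1 := morph_mul1 fM.
suff <- : f (x ^+ k)%g = (f x ^+ k)%g by apply: fB.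
by elim: (k) => [|m IHm]; rewrite ?f1// !expgS fM IHm.
Qed.

Lemma lower_central_morph f H j : (forall x y, f (x * y)%g = (f x * f y)%g) ->
    subgroup H -> (forall x, H x -> H (f x)) ->
  forall x, lower_central H j x -> lower_central H j (f x).
Proof.
move=> fM sH fH; elim: j => [//|j IHj].
have f1 := morph_mul1 fM; have fV := morph_mulV fM.
have sC := lower_central_subgroup j.+1 sH.
apply: (@commutator_min _ _ _ [set x | lower_central H j.+1 (f x)]).
  split=> [|x y /= Cx Cy]; first by rewrite /= f1; apply: subgroup1.
  by rewrite fM fV; apply: sC.2.
move=> x y Lx Hy; rewrite /= commgEl conjgE !fM !fV -conjgE -commgEl.
by apply: commutator_sub; [apply: IHj | apply: fH].
Qed.

Lemma embedding_zexp A B n (q : G -> 'rV[int]_n) x z : subgroup A ->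
  Zn_embedding A B q -> A x -> q (zexp x z) = z *: q x.
Proof.
move=> sA qE Ax; have [qM _] := qE.
have qX k : q (x ^+ k)%g = k%:Z *: q x.
  elim: k => [|k IHk].
    by rewrite scale0r; apply: (addrI (q 1%g)); rewrite -qM ?mulg1 ?addr0//;
      apply: subgroup1.
  by rewrite expgS qM ?IHk ?intS ?scalerDl ?scale1r//; apply: subgroupX.
case: z => k; first exact: qX.
by rewrite NegzE scaleNr -qX -(embeddingV sA qE)//; apply: subgroupX.
Qed.

(* [p], evaluated at the conjugation by [x] and applied to [y], in
   multiplicative notation *)
Definition poly_act x y (p : seq int) : G :=
  foldr (fun c t => inner x t * zexp y c)%g 1%g p.

Lemma poly_act_in A x y p : subgroup A -> (forall t, A t -> A (inner x t)) ->
  A y -> A (poly_act x y p).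
Proof.
move=> sA nA Ay; elim: p => [|c p IHp] /=; first exact: subgroup1.
by apply: subgroupM => //; [apply: nA | apply: subgroup_zexp].
Qed.

Lemma poly_actE A B n (q : G -> 'rV[int]_n.+1) M x y p : subgroup A ->
    (forall t, A t -> A (inner x t)) -> Zn_embedding A B q ->
    induced_mx (inner x) A q M -> A y ->
  q (poly_act x y p) = q y *m horner_mx M (Poly p).
Proof.
move=> sA nA qE qM Ay; have [qD _] := qE; elim: p => [|c p IHp].
  rewrite rmorph0 mulmx0; apply: (addrI (q 1%g)).
  by rewrite -qD ?mulg1 ?addr0//; apply: subgroup1.
have Ap := poly_act_in p sA nA Ay.
rewrite /= cons_poly_def rmorphD rmorphM /= horner_mx_X horner_mx_C.
rewrite qD; [|exact: nA|exact: subgroup_zexp].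
rewrite qM// IHp (embedding_zexp _ sA qE)// mulmxDr mul_mx_scalar.
by rewrite -mulmxE mulmxA.
Qed.

(** * The filtration of a subgroup of an NR-group *)

Section Filtration.
Variables (N D : set G).
Hypotheses (NR_N : NR_group N) (sD : subgroup D) (DN : D `<=` N).
Let H := root_commutator D.
Let c := nilpotency_class H.
Let F := NR_filtration D.

Lemma NR_subgroup : subgroup N.
Proof. by case: NR_N => [[? [? []]]]. Qed.

(** Both properties are inherited from the torsion-free nilpotent kernel [K] given for [N], which
    contains [H]; so the filtration can be studied for every subgroup [D] of [N]. *)
Lemma root_commutator_facts :
  nilpotent H /\ forall x k, (0 < k)%N -> H x -> (x ^+ k)%g = 1%g -> x = 1%g.
Proof.
have [_ [K [n [q [qq sK _ tfK nK]]]] _] := NR_N.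
have HK : H `<=` K.
  move=> x /(root_commutatorS DN).
  exact: (root_commutator_sub_kernel NR_subgroup qq).
split; first exact: nilpotent_sub (root_commutator_subgroup sD) HK nK.
by move=> x k k0 /HK Kx xk; apply: tfK => //; exists k.
Qed.

Let sH : subgroup H := root_commutator_subgroup sD.
Let nH : normal_in H D := root_commutator_normal sD.
Let nilH : nilpotent H := root_commutator_facts.1.

Lemma filtration1 : F 1%N = H.
Proof.
apply/seteqP; split=> [x []//|x Hx]; split=> //; by exists 1%N.
Qed.

Lemma filtration_subH i : F i.+1 `<=` H. Proof. by move=> x []. Qed.

Lemma filtration_normal i : normal_in (F i) D.
Proof.
case: i => [|i]; first exact: normal_refl.
split.
- by apply: isolator_subgroup => //; apply: lower_central_normal.
- by move=> x /filtration_subH; apply: (normal_sub nH).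
have nHD g x : D g -> H x -> H (inner g x) by apply: normal_inner nH.
by apply: isolator_conj => // g x; apply: lower_central_conj.
Qed.

Lemma filtration_dec i : F i.+1 `<=` F i.
Proof.
case: i => [|i]; first exact: (normal_sub (filtration_normal 1)).
by apply: isolatorS; apply: lower_central_dec.
Qed.

Lemma filtration_last : F c.+1 = [set 1%g].
Proof.
rewrite /F /= -/H (nilpotency_classP nilH).
apply/seteqP; split=> [x [Hx [k k0 xk]]|_ ->].
  exact: (root_commutator_facts.2 x k).
by split; [exact: subgroup1 | exists 1%N].
Qed.

Lemma filtration_isolated i x k : (0 < k)%N -> F i x -> F i.+1 (x ^+ k)%g ->
  F i.+1 x.
Proof.
move=> k0; case: i => [|i] Fx; last first.
  by apply: isolatorP => //; apply: filtration_subH Fx.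
by rewrite filtration1; apply: isolatorP.
Qed.

(** [H / F i.+2] is nilpotent and torsion-free, so its centre is closed under roots. A power of [x]
    lies in the lower central series and is therefore central there; hence so is [x]. *)
Lemma filtration_comm i x y : F i.+1 x -> H y -> F i.+2 [~ x, y]%g.
Proof.
move=> [Hx [k k0 xk]] Hy.
have nF : normal_in (F i.+2) H.
  apply: normalS (filtration_normal _) _ _ (normal_sub nH) => //.
  exact: filtration_subH.
have [||_ ] := @upper_central1_isolated _ _ _ sH nF nilH _ x k k0 Hx;
  last by apply.
  by move=> z l l0 Hz; apply: (isolatorP l0).
split; first exact: subgroupX.
move=> h Hh; apply: sub_isolator; last exact: commutator_sub.
exact: (normal_sub (lower_central_normal i.+1 sH)).
Qed.

Lemma filtration_comm0 x y : D x -> D y -> F 1%N [~ x, y]%g.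
Proof.
move=> Dx Dy; rewrite filtration1; apply: sub_isolator.
  exact: (normal_sub (commutator_normal sD)).
exact: commutator_sub.
Qed.

(** Each factor is an abelian section of the polycyclic group [N], torsion-free because the terms
    are closed under roots. *)
Lemma filtration_quotient i : exists n (q : G -> 'rV[int]_n),
  Zn_quotient (F i) (F i.+1) q.
Proof.
have [pN _ _] := NR_N; have nFi := filtration_normal i.
have FD := normal_sub nFi; have sF := normal_subgroup nFi.
apply: (Zn_quotient_exists pN) => //.
- by move=> x /FD /DN.
- apply: normalS FD => //; first exact: filtration_normal.
  exact: filtration_dec.
- case: i nFi FD sF => [|i] nFi FD sF x y Fx Fy; first exact: filtration_comm0.
  by apply: filtration_comm => //; apply: filtration_subH Fy.
by move=> x e e0; apply: filtration_isolated.
Qed.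

Lemma filtration_invariant f i : (forall x y, f (x * y)%g = (f x * f y)%g) ->
  (forall x, D x -> D (f x)) -> forall x, F i x -> F i (f x).
Proof.
move=> fM fD; case: i => [//|i] x Fx.
have fH y : H y -> H (f y).
  apply: isolator_morph => // z.
  exact: (lower_central_morph (j := 1) fM sD fD).
by apply: isolator_morph Fx => // z; apply: lower_central_morph.
Qed.

(* An eigenvalue of the conjugation by [x] on [F i / F i.+1] is an eigenvalue of
   this conjugation on a factor of the given central series [H_] of [N]: by
   Cayley-Hamilton, the product of its characteristic polynomials on these
   factors kills [F i / F i.+1], which is filtered by the images of the
   [F i `&` H_ j]. *)
Lemma filtration_NR i x n (q : G -> 'rV[int]_n) M : D x ->
  Zn_quotient (F i.+1) (F i.+2) q -> induced_mx (inner x) (F i.+1) q M ->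
  no_root_of_unity M.
Proof.
move=> Dx qq qx; have [_ _ [e [H_ [H_0 H_e nH_ stepH_]]]] := NR_N.
have sN := NR_subgroup; have Nx := DN Dx.
case: n q M qq qx => [|n] q M qq qx.
  by move=> z /eigenvalueP[v _]; rewrite thinmx0 eqxx.
have qE := Zn_quotient_embedding qq; have nFi := filtration_normal i.+1.
have sFi := normal_subgroup nFi.
have FiH0 : F i.+1 `<=` H_ 0%N.
  by rewrite H_0 => y /filtration_subH; apply: root_commutatorS.
have xFi t : F i.+1 t -> F i.+1 (inner x t) by apply: (normal_inner nFi).
have [p pP p0] : exists2 p : {poly int},
    forall v, exists2 t, (F i.+1 `&` H_ e) t & q t = v *m horner_mx M p &
    forall z : algC, root (map_poly intr p) z ->
      (exists2 k, (0 < k)%N & z ^+ k = 1) -> z = 1.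
  have : (e <= e)%N by []; move: {-2}e; elim=> [_|j IHj je].
    exists 1 => [v|z]; last by rewrite rmorph1 (negPf (root1 z)).
    have [_ qsurj _ _] := qq; have [t Ft qt] := qsurj v.
    by exists t; [split=> //; apply: FiH0 | rewrite rmorph1 mulmx1].
  have [p pP p0] := IHj (ltnW je).
  have [_ _ [m [r rr]] NRj] := stepH_ j je.
  have nHj := nH_ _ (ltnW je); have sHj := normal_subgroup nHj.
  have xHj t : H_ j t -> H_ j (inner x t) by apply: (normal_inner nHj).
  have [R RP] : exists R, induced_mx (inner x) (H_ j) r R.
    apply: (induced_mx_exists sHj rr) => // [? ? _ _|t]; first exact: innerM.
    by apply: (normal_inner (nH_ _ je)).
  case: m r rr R RP => [|m] r rr R RP.
    exists p => // v; have [t [Ft Ht] qt] := pP v; exists t => //; split=> //.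
    by have [_ _ _ rK] := rr; apply/rK => //; rewrite thinmx0.
  exists (p * char_poly R) => [v|z]; last first.
    rewrite rmorphM /= rootM => /orP[/p0//|].
    rewrite map_char_poly -eigenvalue_root_char; apply: NRj RP _ => //.
  have [t [Ft Ht] qt] := pP v; exists (poly_act x t (char_poly R)).
    split; first exact: poly_act_in.
    have [_ _ _ rK] := rr; apply/rK; first exact: poly_act_in.
    rewrite (poly_actE _ sHj xHj (Zn_quotient_embedding rr) RP)//.
    by rewrite polyseqK Cayley_Hamilton mulmx0.
  rewrite (poly_actE _ sFi xFi qE qx)// polyseqK qt -mulmxA rmorphM.
  by [].
have pM : horner_mx M p = 0.
  apply/row_matrixP => k; rewrite row0 rowE; have [t [_ ]] := pP (delta_mx 0 k).
  rewrite H_e => -> <-; have [qD _] := qE.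
  by apply: (addrI (q 1%g)); rewrite -qD ?mulg1 ?addr0//; apply: subgroup1.
move=> z /eigenvalueP[v vM v0]; apply: p0; rewrite /root.
have pz : v *m horner_mx (map_mx intr M) (map_poly intr p) =
    (map_poly intr p).[z] *: v.
  elim/poly_ind: (map_poly intr p) => [|s b IHs].
    by rewrite rmorph0 mulmx0 horner0 scale0r.
  rewrite rmorphD rmorphM /= horner_mx_X horner_mx_C mulmxDr mul_mx_scalar.
  rewrite -mulmxE mulmxA IHs -scalemxAl vM scalerA -scalerDl.
  by rewrite !hornerE.
move: pz; rewrite -map_horner_mx pM raddf0 mulmx0 => /esym/eqP.
by rewrite scaler_eq0 (negPf v0) orbF.
Qed.

End Filtration.
End NR.

(** * Twisted conjugacy in an NR-group *)

Section Count.
Variable G : groupType.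
Implicit Types (A B H K S V P : set G) (x y g h u v : G) (f : G -> G).

Lemma induced_mx_eq A B n (q : G -> 'rV[int]_n) f (g : G -> G) M M' :
  Zn_quotient A B q ->
  induced_mx f A q M -> induced_mx g A q M' ->
  (forall u, A u -> q (f u) = q (g u)) -> M = M'.
Proof.
move=> [_ qsurj _ _] fM gM' fg; apply/row_matrixP => i; rewrite !rowE.
by have [u Au <-] := qsurj (delta_mx 0 i); rewrite -fM// -gM'// fg.
Qed.

Definition tw_class D f x : set G :=
  [set y | exists h, D h /\ y = (h * x * (f h)^-1)%g].

Definition tw_classes D f : set (set G) := tw_class D f @` D.

Lemma tw_class_eq D f x y : (forall u v, f (u * v)%g = (f u * f v)%g) ->
  subgroup D -> tw_class D f x = tw_class D f y <->
  exists2 h, D h & y = (h * x * (f h)^-1)%g.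
Proof.
move=> fM sD; have f1 := morph_mul1 fM; have fV := morph_mulV fM.
split=> [xy|[h Dh ->]].
  have : tw_class D f y y.
    by exists 1%g; split; [exact: subgroup1 | rewrite f1 mul1g invg1 mulg1].
  by rewrite -xy => -[h [Dh ->]]; exists h.
apply/seteqP; split=> _ [k [Dk ->]].
  by exists (k * h^-1)%g; split; [exact: sD.2 | rewrite fM fV !gnorm].
by exists (k * h)%g; split; [exact: subgroupM | rewrite fM !gnorm].
Qed.

Variables (N D : set G).
Hypotheses (NR_N : NR_group N) (sD : subgroup D) (DN : D `<=` N).
Variable psi : G -> G.
Hypotheses (psiM : forall x y, psi (x * y)%g = (psi x * psi y)%g)
  (psiD : forall x, D x -> D (psi x)).
Let F := NR_filtration D.
Let c := nilpotency_class (root_commutator D).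
Let nF i : normal_in (F i) D := filtration_normal NR_N sD DN i.
Let sF i : subgroup (F i) := normal_subgroup (nF i).
Let FD i : F i `<=` D := normal_sub (nF i).
Let Fdec i : F i.+1 `<=` F i := @filtration_dec _ _ _ NR_N sD DN i.
Let psiF i x : F i x -> F i (psi x) :=
  @filtration_invariant _ _ sD psi i psiM psiD x.

Let psi1 : psi 1%g = 1%g := morph_mul1 psiM.
Let psiV x : psi x^-1%g = (psi x)^-1%g := morph_mulV psiM x.

Lemma twistM x u v :
  inner x (psi (u * v)%g) = (inner x (psi u) * inner x (psi v))%g.
Proof. by rewrite psiM innerM. Qed.

Lemma twistF i x u : D x -> F i u -> F i (inner x (psi u)).
Proof. by move=> Dx /psiF; apply: (normal_inner (nF i)). Qed.

Lemma twist_mx_exists i x n (q : G -> 'rV[int]_n) : D x ->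
  Zn_quotient (F i) (F i.+1) q ->
  exists M, induced_mx (inner x \o psi) (F i) q M.
Proof.
move=> Dx qq; apply: (induced_mx_exists (sF i) qq) => [u v _ _|u|u].
- exact: twistM.
- exact: twistF.
- exact: twistF.
Qed.

(** No [iota_x psi] with [x] in [D] fixes a nonzero element of [F i / F i.+1]. *)
Definition nonsingular i := forall x n (q : G -> 'rV[int]_n) M, D x ->
  Zn_quotient (F i) (F i.+1) q -> induced_mx (inner x \o psi) (F i) q M ->
  \det (1%:M - M) != 0.

(** The fixed point is pushed down the filtration: its image in each factor [F j / F j.+1] is a
    fixed vector, hence 0. *)
Lemma nonsingular_fix i x h : (forall j, (j < i)%N -> nonsingular j) ->
  D x -> D h -> eqmod (F i) h (inner x (psi h)) -> F i h.
Proof.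
move=> ns Dx Dh Fh; suff: forall j, (j <= i)%N -> F j h by apply.
elim=> [//|j IHj] ji; have Fjh := IHj (ltnW ji).
have [n [q qq]] := filtration_quotient NR_N sD DN j.
have qE := Zn_quotient_embedding qq.
have [M MP] := twist_mx_exists Dx qq.
have FjSi : F i `<=` F j.+1.
  move: ji; elim: (i) => // k IHk; rewrite leq_eqVlt => /predU1P[[->]//|jk].
  by move=> u /Fdec; apply: IHk.
have qh : q h = q h *m M.
  rewrite -MP//; apply/(embedding_eq (sF j) qE) => //; first exact: twistF.
  exact: FjSi.
apply/qE.2 => //; have dM := ns j ji x n q M Dx qq MP.
have qh0 : q h *m (1%:M - M) = 0 by rewrite mulmxBr mulmx1 -qh subrr.
(* Over the integers, the adjugate takes the place of the inverse of [1 - M]. *)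
have := congr1 (mulmx^~ (\adj (1%:M - M))) qh0.
rewrite /= -mulmxA mul_mx_adj mul0mx mul_mx_scalar => /rowP qd0.
apply/rowP => k; have := qd0 k; set d := \det _ in dM *; clearbody d.
by rewrite !mxE => /eqP; rewrite mulf_eq0 (negPf dM) => /eqP.
Qed.

(* With [rho y] the matrix of the conjugation by [y], [M * rho x ^+ j] is, up to
   conjugation, periodic in [j]: as 1 is not an eigenvalue of [psi] on the first
   factor, some power of [x] is of the form [z * (psi z)^-1] modulo [F 1]. *)
Lemma det_twist i x n (q : G -> 'rV[int]_n) M Mx : nonsingular 0 -> D x ->
    Zn_quotient (F i) (F i.+1) q -> induced_mx psi (F i) q M ->
    induced_mx (inner x \o psi) (F i) q Mx ->
  \det (1%:M - Mx) = \det (1%:M - M).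
Proof.
move=> ns0 Dx qq MP MxP; have qE := Zn_quotient_embedding qq.
have [qD _] := qE.
case: i qq MP MxP qE qD => [|i] qq MP MxP qE qD.
  (* [D / F 1] is abelian, so conjugation acts trivially on it and [Mx = M]. *)
  rewrite (induced_mx_eq qq MxP MP)// => u Du /=.
  apply/(embedding_eq sD qE); [exact: (@twistF 0)|exact: psiD|].
  have Dpu := psiD Du.
  rewrite /eqmod (_ : (_ * _)%g = [~ x^-1, (psi u)^-1]%g); last first.
    by rewrite /inner commgEl conjgE !gnorm.
  by apply: filtration_comm0 => //; apply: subgroupV.
case: n q M Mx qq MP MxP qE qD => [|n] q M Mx qq MP MxP qE qD.
  by rewrite !det_mx00.
have inF y u : D y -> F i.+1 u -> F i.+1 (inner y u).
  by move=> Dy; apply: (normal_inner (nF _)).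
have /choice[rho rhoP] : forall y, exists R,
    D y -> induced_mx (inner y) (F i.+1) q R.
  move=> y; have [Dy|nDy] := pselect (D y); last by exists 0.
  have [R RP] : exists R, induced_mx (inner y) (F i.+1) q R; last by exists R.
  apply: (induced_mx_exists (sF _) qq) => [u v _ _|u|u]; first exact: innerM.
    exact: inF.
  by apply: (normal_inner (nF _)).
(* Matrices act on row vectors, so [rho] reverses products. *)
have rhoM y z : D y -> D z -> rho (y * z)%g = rho z * rho y.
  move=> Dy Dz; apply: (induced_mx_eq qq (rhoP _ (subgroupM sD Dy Dz))
    (g := inner y \o inner z)) => [u Fu|u Fu] /=.
    by rewrite rhoP ?rhoP ?mulmxA//; apply: inF.
  by congr q; rewrite /inner !gnorm.
(* [F 1] acts trivially on the factor by [filtration_comm], so [rho] factors through the abelian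
   group [D / F 1]. *)
have rho_eq y z : D y -> D z -> eqmod (F 1%N) y z -> rho y = rho z.
  move=> Dy Dz Fyz; apply: (induced_mx_eq qq (rhoP _ Dy) (rhoP _ Dz)) => u Fu.
  set t := (y * z^-1)%g in Fyz; have Ht : root_commutator D t.
    by rewrite -(filtration1 D).
  have -> : inner y u = inner t (inner z u) by rewrite /inner /t !gnorm.
  have Fzu := inF z u Dz Fu.
  apply/(embedding_eq (sF _) qE) => //.
    by apply: inF => //; apply: sD.2.
  rewrite /eqmod (_ : (_ * _)%g = [~ (inner z u)^-1, t^-1]^-1%g); last first.
    by rewrite /inner commgEl conjgE !gnorm.
  apply: subgroupV => //; apply: (filtration_comm NR_N sD DN).
    exact: subgroupV.
  by apply: subgroupV => //; exact: root_commutator_subgroup.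
have rhoC y z : D y -> D z -> rho y * rho z = rho z * rho y.
  move=> Dy Dz; rewrite -!rhoM//; apply: rho_eq; try exact: subgroupM.
  rewrite /eqmod (_ : (_ * _)%g = [~ z^-1, y^-1]%g); last first.
    by rewrite commgEl conjgE !gnorm.
  by apply: filtration_comm0 => //; apply: subgroupV.
have rho1 : rho 1%g = 1.
  apply: (induced_mx_eq qq (rhoP _ (subgroup1 sD)) (g := id)) => [u _|u _].
    by rewrite mulmx1.
  by rewrite /inner mul1g invg1 mulg1.
have rhoX y k : D y -> rho (y ^+ k)%g = rho y ^+ k.
  move=> Dy; elim: k => [|k IHk]; first by rewrite rho1.
  by rewrite expgS rhoM ?IHk ?exprSr//; apply: subgroupX.
have rho_psi y : D y -> rho y * M = M * rho (psi y).
  move=> Dy; apply: (induced_mx_eq qq (f := psi \o inner y)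
      (g := inner (psi y) \o psi)) => u Fu /=.
  - by rewrite MP ?rhoP ?mulmxA//; apply: inF.
  - by rewrite rhoP ?MP ?mulmxA//; [exact: psiD | exact: psiF].
  - by rewrite /inner !psiM psiV.
have -> : Mx = M * rho x.
  apply: (induced_mx_eq qq MxP (g := inner x \o psi)) => // u Fu /=.
  by rewrite rhoP ?MP ?mulmxA//; apply: psiF.
(* Here [y k = x psi(x) .. psi^(k-1)(x)], chosen so that [(M * rho x) ^+ k = M ^+ k * rho (y k)]. *)
pose y k := iter k (fun t => x * psi t)%g 1%g.
have Dy k : D (y k).
  elim: k => [|k IHk]; first exact: subgroup1.
  by apply: subgroupM => //; apply: psiD.
have [m m0 [z Dz zx]] : exists2 m, (0 < m)%N & exists2 z, D z &
    eqmod (F 1%N) (x ^+ m)%g (z * (psi z)^-1)%g.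
  have [n0 [q0 qq0]] := filtration_quotient NR_N sD DN 0.
  have qE0 := Zn_quotient_embedding qq0; have [qD0 qsurj0 _ _] := qq0.
  have [M0 M0P] : exists M0, induced_mx psi (F 0) q0 M0.
    apply: (induced_mx_exists sD qq0) => // u; exact: (@psiF 1).
  have d_neq0 : \det (1%:M - M0) != 0.
    apply: (ns0 1%g _ _ _ (subgroup1 sD) qq0) => u Du /=.
    by rewrite /inner mul1g invg1 mulg1 M0P.
  (* The adjugate solves [q0 z *m (1 - M0) = |d| q0 x]; the sign of [d] is put into [z] so that the
     exponent [m = |d|] is positive. *)
  set d := \det _ in d_neq0; exists `|d|%N; first by rewrite absz_gt0.
  have [z Dz qz] := qsurj0 (sgz d *: (q0 x *m \adj (1%:M - M0))).
  exists z => //; apply/(embedding_eq sD qE0).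
  - exact: subgroupX.
  - by apply: subgroupM => //; apply: subgroupV => //; apply: psiD.
  rewrite qD0 ?(embeddingV sD qE0)//; try exact: psiD; last first.
    by apply: subgroupV => //; apply: psiD.
  rewrite M0P// -[X in _ = X - _]mulmx1 -mulmxBr qz -scalemxAl -mulmxA.
  rewrite mul_adj_mx -/d mul_mx_scalar scalerA -abszEsg.
  by rewrite -(embedding_zexp _ sD qE0).
apply: (det_sub1_twist (Y := fun k => rho (y k)) m0).
- move=> k; exact: (filtration_NR NR_N sD DN (Dy k) qq (rhoP _ (Dy k))).
- move=> k j; elim: k => [|k IHk]; first by rewrite /= !expr0 rho1 expr1n mulr1.
  rewrite exprSr IHk [RHS]/= rhoM ?Dy//; last exact: psiD.
  rewrite exprMn_comm; last by apply: rhoC => //; apply: psiD.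
  rewrite !mulrA; congr (_ * _); rewrite exprSr -!mulrA; congr (_ * _).
  elim: j {IHk} => [|j IHj]; first by rewrite !expr0 mulr1 mul1r.
  by rewrite exprS -mulrA IHj mulrA rho_psi// -mulrA -exprS.
move=> j; have Dpz := psiD Dz; have Dz' := subgroupV sD Dz.
have Dpz' := subgroupV sD Dpz.
have rhoV t : D t -> rho t * rho t^-1%g = 1 /\ rho t^-1%g * rho t = 1.
  move=> Dt; have Dt' := subgroupV sD Dt.
  by rewrite -!rhoM ?mulgV ?mulVg ?rho1.
have [zV Vz] := rhoV z Dz; have [pzV Vpz] := rhoV _ Dpz.
have uz : rho z^-1%g \is a GRing.unit by apply/unitrP; exists (rho z).
(* As [x^m] is [z psi(z)^-1] modulo [F 1], and [rho_psi] moves [rho] across [M], a shift of [j] by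
   [m] conjugates the matrix by [rho z^-1]. *)
exists (rho z^-1%g) => //.
have -> : (rho z^-1%g)^-1 = rho z.
  by apply: (mulrI uz); rewrite mulrV ?Vz.
have -> : rho x ^+ (j + m) = rho (psi z)^-1%g * rho x ^+ j * rho z.
  rewrite exprD -[rho x ^+ m]rhoX// (rho_eq _ _ _ _ zx) ?rhoM//.
  - by rewrite mulrA; congr (_ * _); rewrite -!rhoX// rhoC//; apply: subgroupX.
  - exact: subgroupX.
  - exact: subgroupM.
rewrite !mulrA; congr (_ * _ * _).
by rewrite -[RHS]mulr1 -pzV mulrA -[_ * M * _]mulrA -rho_psi// mulrA Vz mul1r.
Qed.

(** Twisted conjugacy of the images in [D / F i], expressed on elements of [D]. *)
Definition tw_rel i x y :=
  exists2 h, D h & eqmod (F i) y (h * x * (psi h)^-1)%g.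

Lemma tw_relxx i x : tw_rel i x x.
Proof.
exists 1%g; first exact: subgroup1.
by rewrite psi1 mul1g invg1 mulg1; apply: (eqmod_refl (nF i)).
Qed.

Lemma tw_rel_sym i x y : D x -> D y -> tw_rel i x y -> tw_rel i y x.
Proof.
move=> Dx Dy [h Dh yx]; exists h^-1%g; first exact: subgroupV.
have Dh' := subgroupV sD Dh.
apply: (eqmod_sym (nF i)); rewrite psiV invgK.
rewrite [X in eqmod _ _ X](_ : x = h^-1 * (h * x * (psi h)^-1) * psi h)%g;
  last first.
  by rewrite !gnorm.
apply: (eqmodM (nF i)); [exact: subgroupM| |exact: (eqmod_refl (nF i))].
by apply: (eqmodM (nF i)) => //; exact: (eqmod_refl (nF i)).
Qed.

Lemma tw_rel_trans i y x z : D x -> D y -> tw_rel i x y -> tw_rel i y z ->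
  tw_rel i x z.
Proof.
move=> Dx Dy [h Dh yx] [k Dk zy]; exists (k * h)%g; first exact: subgroupM.
apply: (eqmod_trans (nF i) zy).
rewrite psiM invgM.
rewrite (_ : k * h * x * _ = k * (h * x * (psi h)^-1) * (psi k)^-1)%g;
  last first.
  by rewrite !gnorm.
apply: (eqmodM (nF i)); [exact: subgroupM| |exact: (eqmod_refl (nF i))].
by apply: (eqmodM (nF i)) => //; exact: (eqmod_refl (nF i)).
Qed.

Lemma tw_relS i x y : tw_rel i.+1 x y -> tw_rel i x y.
Proof. by move=> [h Dh yx]; exists h => //; apply: Fdec. Qed.

Definition tw_cell i x : set G := [set y | D y /\ tw_rel i x y].

Definition tw_cells i : set (set G) := tw_cell i @` D.

Lemma tw_cellP i x y : D x -> D y -> tw_cell i x = tw_cell i y <-> tw_rel i x y.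
Proof.
move=> Dx Dy; split=> [xy|xy].
  have : tw_cell i y y by split=> //; apply: tw_relxx.
  by rewrite -xy => -[].
apply/seteqP; split=> z [Dz Rz]; split=> //.
  by apply: tw_rel_trans Rz => //; apply: tw_rel_sym.
exact: tw_rel_trans Rz.
Qed.

Lemma tw_cells0 : tw_cells 0 = [set tw_cell 0 1%g].
Proof.
apply/seteqP; split=> [_ [x Dx <-]|_ ->]; last first.
  by exists 1%g => //; apply: subgroup1.
apply/tw_cellP => //; first exact: subgroup1.
exists 1%g; first exact: subgroup1.
rewrite psi1 mul1g invg1 mulg1 /eqmod mul1g; exact: subgroupV.
Qed.

Lemma tw_cells_last : tw_cells c.+1 = tw_classes D psi.
Proof.
apply: eq_imagel => x Dx; apply/seteqP; split=> y.
  move=> [Dy [h Dh]]; rewrite /eqmod /F (filtration_last NR_N sD DN) =>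
    /divg1_eq ->.
  by exists h.
move=> [h [Dh ->]]; split; last first.
  by exists h => //; apply: (eqmod_refl (nF c.+1)).
by apply: sD.2; [apply: subgroupM | apply: psiD].
Qed.

Let repr (C : set G) : G := xget 1%g C.

Lemma tw_cells_repr i j x : D x -> (forall y, tw_rel j x y -> tw_rel i x y) ->
  tw_cell i (repr (tw_cell j x)) = tw_cell i x.
Proof.
move=> Dx ji; rewrite /repr; case: xgetP => [y _ [Dy Ry]|/(_ x)[]]; last first.
  by split=> //; apply: tw_relxx.
by apply/esym/tw_cellP => //; apply: ji.
Qed.

Lemma tw_cells_image i :
  tw_cells i = (fun C => tw_cell i (repr C)) @` tw_cells i.+1.
Proof.
apply/seteqP; split=> [_ [x Dx <-]|_ [_ [x Dx <-] <-]].
  by exists (tw_cell i.+1 x); [exists x | rewrite tw_cells_repr// => y;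
    apply: tw_relS].
by rewrite tw_cells_repr//; [exists x | move=> y; apply: tw_relS].
Qed.

(** Any [y] in the cell of [x] modulo [F i] is twisted conjugate to some [u x] with [u] in [F i], so
    these products represent all finer cells above it. *)
Lemma tw_cells_fibre i x : D x ->
  tw_cells i.+1 `&` (fun C => tw_cell i (repr C)) @^-1` [set tw_cell i x] =
  (fun u => tw_cell i.+1 (u * x)%g) @` F i.
Proof.
move=> Dx; apply/seteqP; split=> [_ [[y Dy <-] /= ]|_ [u Fu <-]].
  rewrite tw_cells_repr// => [/tw_cellP-/(_ Dy Dx)[h Dh Fh]|z];
    last exact: tw_relS.
  pose u := (h * y * (psi h)^-1 * x^-1)%g.
  have Dhy : D (h * y * (psi h)^-1)%g.
    by apply: sD.2; [apply: subgroupM | apply: psiD].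
  have Fu : F i u by apply: (eqmod_sym (nF i)) Fh.
  exists u => //; apply/tw_cellP => //; first by rewrite /u mulgVK.
  apply: tw_rel_sym => //; first by rewrite /u mulgVK.
  by exists h => //; rewrite /u mulgVK; apply: (eqmod_refl (nF _)).
have Dux : D (u * x)%g by apply: subgroupM => //; apply: (FD Fu).
split; first by exists (u * x)%g.
rewrite /= tw_cells_repr//; last by move=> y; apply: tw_relS.
apply/tw_cellP => //; exists 1%g; first exact: subgroup1.
rewrite psi1 mul1g invg1 mulg1 /eqmod invgM mulVKg.
exact: subgroupV.
Qed.

(** An [h] carrying [u x] to [v x] modulo [F i.+1] is fixed by [iota_x psi] modulo [F i], hence lies
    in [F i] by [nonsingular_fix]. The relation then reads [q v - q u = q h (1 - M)], and the fibre
    is a cokernel. *)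
Lemma ncard_fibre i x n (q : G -> 'rV[int]_n) M :
    (forall j, (j < i)%N -> nonsingular j) -> D x ->
    Zn_quotient (F i) (F i.+1) q -> induced_mx (inner x \o psi) (F i) q M ->
    let S := (fun u => tw_cell i.+1 (u * x)%g) @` F i in
    finite_set S ->
  \det (1%:M - M) != 0 /\ ncard S = `|\det (1%:M - M)|%N.
Proof.
move=> ns Dx qq MP S Sfin; have qE := Zn_quotient_embedding qq.
have [qD qsurj _ _] := qq; have qeq := embedding_eq (sF i) qE.
have Dux u : F i u -> D (u * x)%g.
  by move=> Fu; apply: subgroupM => //; apply: (FD Fu).
have /choice[s sP] : forall v : 'rV_n, exists u, F i u /\ q u = v.
  by move=> v; have [u Fu qu] := qsurj v; exists u.
have relP u v : F i u -> F i v -> tw_rel i.+1 (u * x)%g (v * x)%g <->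
    exists w, q v - q u = w *m (1%:M - M).
  move=> Fu Fv.
  have relE h : D h -> F i h ->
      eqmod (F i.+1) (v * x)%g (h * (u * x) * (psi h)^-1)%g <->
      q v - q u = q h *m (1%:M - M).
    move=> Dh Fh; have Ft : F i (inner x (psi h)) by apply: twistF.
    have Ft' := subgroupV (sF i) Ft; have Fhu := subgroupM (sF i) Fh Fu.
    have -> : eqmod (F i.+1) (v * x)%g (h * (u * x) * (psi h)^-1)%g =
              eqmod (F i.+1) v (h * u * (inner x (psi h))^-1)%g.
      by congr (F i.+1 _); rewrite /inner !gnorm.
    rewrite -qeq//; last exact: subgroupM.
    rewrite qD// qD// (embeddingV (sF i) qE)// -/((inner x \o psi) h) MP//.
    rewrite mulmxBr mulmx1 [q h + _]addrC -addrA; split=> [->|<-].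
      by rewrite [q u + _]addrC addrK.
    by rewrite addrC subrK.
  split=> [[h Dh vu]|[w vw]]; last first.
    have [Fw qw] := sP w; exists (s w); first exact: FD Fw.
    by apply/relE => //; [exact: FD Fw | rewrite qw].
  suff Fh : F i h by exists (q h); apply/relE.
  apply: (nonsingular_fix ns Dx Dh).
  set t := inner x (psi h).
  have Dt : D t by apply: (@twistF 0).
  have Fvh : eqmod (F i) v (h * u * t^-1)%g.
    apply: Fdec; move: vu; rewrite /eqmod; congr (F i.+1 _).
    by rewrite /t /inner !gnorm.
  rewrite /eqmod -[h](mulgK u) -mulgA (_ : u^-1 * t^-1 = t^-1 * inner t u^-1)%g.
    by rewrite mulgA; apply: subgroupM => //; [apply/(eqmod_mem (nF i) Fvh)|
      apply: (normal_inner (nF i)) => //; apply: subgroupV].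
  by rewrite /inner !gnorm.
have [g gE] : exists g : 'rV_n -> set G,
    forall v : 'rV_n, g v = tw_cell i.+1 (s v * x)%g.
  by exists (fun v : 'rV_n => tw_cell i.+1 (s v * x)%g).
have SE : S = range g.
  apply/seteqP; split=> [_ [u Fu <-]|_ [v _ <-]]; last first.
    by rewrite gE; have [Fs _] := sP v; exists (s v).
  exists (q u) => //; rewrite gE; have [Fs qs] := sP (q u).
  apply/tw_cellP; [exact: Dux|exact: Dux|]; apply/relP => //.
  by exists 0; rewrite qs subrr mul0mx.
rewrite SE; apply: ncard_coker; last by rewrite -SE.
move=> v w; rewrite !gE; have [[Fv qv] [Fw qw]] := (sP v, sP w).
split=> [/tw_cellP-/(_ (Dux _ Fv) (Dux _ Fw))/relP-/(_ Fv Fw)[t tE]|[t tE]].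
  by exists (- t); rewrite mulNmx -tE qv qw opprB.
apply/tw_cellP; [exact: Dux|exact: Dux|]; apply/relP => //.
by exists (- t); rewrite mulNmx -tE qv qw opprB.
Qed.

(** The factor is some Z^n on which [psi] has a matrix, so the default of [xget] is not taken. *)
Lemma factor_detP i : exists n (q : G -> 'rV[int]_n) (M : 'M[int]_n),
  [/\ Zn_quotient (F i) (F i.+1) q, induced_mx psi (F i) q M &
      factor_det psi (F i) (F i.+1) = \det (1%:M - M)].
Proof.
rewrite /factor_det; case: xgetP => [d _ [n [q [M [? ? ->]]]]|no];
  first by exists n, q, M.
have [n [q qq]] := filtration_quotient NR_N sD DN i.
have [M MP] := induced_mx_exists (sF i) qq (fun u v _ _ => psiM u v)
  (@psiF i) (@psiF i.+1).
by case: (no (\det (1%:M - M))); exists n, q, M.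
Qed.

(** Finiteness descends to the coarser level, where induction makes the previous factors
    nonsingular. The fibre over each cell is then a cokernel, of the same order for all cells by
    [det_twist]. *)
Lemma tw_cells_count i : finite_set (tw_cells i) ->
  (forall j, (j < i)%N -> nonsingular j) /\
  ncard (tw_cells i) = (\prod_(j < i) `|factor_det psi (F j) (F j.+1)|)%N.
Proof.
elim: i => [_|i IHi fin].
  by rewrite big_ord0 tw_cells0 /ncard fset_set1 cardfs1.
have fini : finite_set (tw_cells i).
  by rewrite tw_cells_image; apply: finite_image.
have [ns cardi] := IHi fini.
have fibfin x : D x -> finite_set ((fun u => tw_cell i.+1 (u * x)%g) @` F i).
  by move=> Dx; rewrite -tw_cells_fibre//; apply: finite_setIl.
have nsi : nonsingular i.
  by move=> x n q M Dx qq MP; have [] := ncard_fibre ns Dx qq MP (fibfin x Dx).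
split=> [j|]; first by rewrite ltnS leq_eqVlt => /predU1P[->//|]; apply: ns.
have [n [q [M [qq MP dE]]]] := factor_detP i.
rewrite big_ord_recr /= -cardi dE [tw_cells i]tw_cells_image;
  apply: ncard_uniform_fibres => //.
rewrite -tw_cells_image => _ [x Dx <-]; rewrite tw_cells_fibre//.
have [Mx MxP] := twist_mx_exists Dx qq.
have [_ ->] := ncard_fibre ns Dx qq MxP (fibfin x Dx).
congr `|_|%N; apply: (det_twist _ Dx qq MP MxP).
(* [nonsingular 0] is [nsi] itself when [i = 0], and comes from [ns] otherwise. *)
by case: (i) nsi ns => // k _; apply.
Qed.

(** [F c.+1] is trivial, so the cells of that level are the twisted classes, and [nonsingular_fix]
    with [x = 1] kills the fixed points of [psi]. *)
Theorem tau_count : finite_set (tw_classes D psi) ->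
  ncard (tw_classes D psi) = tau D psi /\ forall h, D h -> psi h = h -> h = 1%g.
Proof.
rewrite -tw_cells_last => fin; have [ns ->] := tw_cells_count fin.
split=> // h Dh ph; have : F c.+1 h.
  apply: (nonsingular_fix ns (subgroup1 sD) Dh).
  by rewrite ph /inner mul1g invg1 mulg1; apply: (eqmod_refl (nF _)).
by rewrite /F (filtration_last NR_N sD DN).
Qed.

End Count.

(** * Orbits of induced actions *)

Local Open Scope group_scope.

Lemma finite_setX_l (T U : Type) (A : set T) (B : set U) b :
  B b -> finite_set (A `*` B) -> finite_set A.
Proof.
move=> Bb fAB; apply: (sub_finite_set _ (finite_image fst fAB)) => a Aa.
by exists (a, b).
Qed.

Lemma finite_setX_r (T U : Type) (A : set T) (B : set U) a :
  A a -> finite_set (A `*` B) -> finite_set B.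
Proof.
move=> Aa fAB; apply: (sub_finite_set _ (finite_image snd fAB)) => b Bb.
by exists (a, b).
Qed.

Section Cosets.
Variable G : groupType.
Implicit Types (A B S N : set G) (x y g h : G).

Lemma left_cosetP B x y : subgroup B ->
  left_coset x B = left_coset y B <-> B (x^-1 * y).
Proof.
move=> sB; split=> [xy|Bxy].
  have : left_coset y B y by exists 1; [exact: subgroup1 | rewrite mulg1].
  by rewrite -xy => -[b Bb <-]; rewrite mulKg.
apply/seteqP; split=> _ [b Bb <-].
  exists ((x^-1 * y)^-1 * b); last by rewrite !gnorm.
  by apply: subgroupM => //; apply: subgroupV.
by exists (x^-1 * y * b); [apply: subgroupM | rewrite !gnorm].
Qed.

Lemma finite_index_sub S N : subgroup S -> subgroup N -> finite_index setT N ->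
  finite_index S (S `&` N).
Proof.
move=> sS sN fN; have sD := subgroupI sS sN.
have fS : finite_set ((fun x => left_coset x N) @` S).
  by apply: sub_finite_set fN => _ [x _ <-]; exists x.
have SN : ((fun x => left_coset x N) @` S #= cosets S (S `&` N))%card.
  apply: card_eq_image => x y Sx Sy; rewrite !left_cosetP//.
  split=> [Nxy|[]//]; split=> //; apply: subgroupM => //.
  exact: subgroupV.
by have [] := card_eq_ncard SN fS.
Qed.

(** Two different powers of [x] lie in one coset of [N]. *)
Lemma finite_index_torsion N x : subgroup N -> finite_index setT N ->
  exists2 k, (0 < k)%N & N (x ^+ k).
Proof.
move=> sN fN; apply: contrapT => nok; apply: infinite_nat.
have card_nat : (range (fun k => left_coset (x ^+ k) N) #= [set: nat])%card.
  apply: inj_card_eq => i j _ _ /left_cosetP-/(_ sN).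
  wlog ij : i j / (i <= j)%N => [wl|].
    have [/wl//|/ltnW/wl ji] := leqP i j.
    by move=> /(subgroupV sN); rewrite invgM invgK => /ji.
  rewrite -{1}(subnKC ij) expgnDr mulKg => Nij; apply/eqP; rewrite eqn_leq ij.
  by rewrite -subn_eq0 -leqn0 leqNgt; apply/negP => ji; apply: nok;
    exists (j - i)%N.
rewrite -(eq_finite_set card_nat).
by apply: sub_finite_set fN => _ [k _ <-]; exists (x ^+ k).
Qed.

End Cosets.

Section Actions.
Variables (G : groupType) (T : choiceType) (act : G -> T -> T).
Hypotheses (act1 : forall z, act 1 z = z)
  (actM : forall g h z, act (g * h) z = act g (act h z)).
Implicit Types (K S N : set G) (X : set T) (g h k : G) (z : T).

Definition orbit K z : set T := act^~ z @` K.

Definition orbits K X : set (set T) := orbit K @` X.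

Lemma actK g z : act g^-1 (act g z) = z.
Proof. by rewrite -actM mulVg act1. Qed.

Lemma actVK g z : act g (act g^-1 z) = z.
Proof. by rewrite -actM mulgV act1. Qed.

Lemma orbit_refl K z : subgroup K -> orbit K z z.
Proof. by move=> sK; exists 1; [exact: subgroup1 | rewrite act1]. Qed.

Lemma orbitP K z z' : subgroup K ->
  orbit K z = orbit K z' <-> exists2 k, K k & z' = act k z.
Proof.
move=> sK; split=> [zz'|[k Kk ->]].
  by have := orbit_refl z' sK; rewrite -zz' => -[k Kk <-]; exists k.
apply/seteqP; split=> _ [h Kh <-]; last first.
  by exists (h * k); [apply: subgroupM | rewrite actM].
exists (h * k^-1); first exact: sK.2.
by rewrite actM actK.
Qed.

(** * Counting orbits along an invariant map *)

Section Fibration.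
Variables (K : set G) (X : set T) (U : choiceType) (p : T -> U).
Hypotheses (sK : subgroup K) (pK : forall k z, K k -> X z -> p (act k z) = p z)
  (z0 : T).
(** [p] read on orbits through a representative; [z0] is only the default of [xget]. *)
Let pr (w : set T) : U := p (xget z0 w).

Lemma orbit_proj z : X z -> pr (orbit K z) = p z.
Proof.
move=> Xz; rewrite /pr; case: xgetP => [_ _ [k Kk <-]|/(_ z)[]];
  first exact: pK.
exact: orbit_refl.
Qed.

Lemma orbits_image : pr @` orbits K X = p @` X.
Proof.
apply/seteqP; split=> [_ [_ [z Xz <-] <-]|_ [z Xz <-]].
  by exists z => //; rewrite orbit_proj.
by exists (orbit K z); [exists z | rewrite orbit_proj].
Qed.

Lemma orbits_fibre b :
  orbits K X `&` pr @^-1` [set b] = orbits K (X `&` p @^-1` [set b]).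
Proof.
apply/seteqP; split=> [_ [[z Xz <-] /= ]|_ [z [Xz <-] <-]].
  by rewrite orbit_proj// => pz; exists z.
by split; [exists z | rewrite /= orbit_proj].
Qed.

Lemma orbits_finite : finite_set (p @` X) ->
  (forall b, (p @` X) b -> finite_set (orbits K (X `&` p @^-1` [set b]))) ->
  finite_set (orbits K X).
Proof.
move=> fp ff; have -> : orbits K X =
    \bigcup_(b in p @` X) orbits K (X `&` p @^-1` [set b]).
  apply/seteqP; split=> [_ [z Xz <-]|_ [b _ [z [Xz _] <-]]]; last by exists z.
  by exists (p z); [exists z | exists z].
exact: bigcup_finite.
Qed.

Lemma orbits_finite_base : finite_set (orbits K X) -> finite_set (p @` X).
Proof. by rewrite -orbits_image; apply: finite_image. Qed.

Lemma ncard_orbits : finite_set (orbits K X) ->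
  ncard (orbits K X) = (\sum_(b <- fset_set (p @` X))
    ncard (orbits K (X `&` p @^-1` [set b])))%N.
Proof.
move=> fX; rewrite (ncard_fibres pr fX) orbits_image.
by apply: eq_bigr => b _; rewrite orbits_fibre.
Qed.

End Fibration.

(* [X] is induced from the action of [S] on [X0]: both sides are the double
   cosets of [G * X0] by [N] and [S `&` N]. *)
Lemma card_orbits_induced N S X X0 : normal_in N setT -> subgroup S ->
    (forall g z, X z -> X (act g z)) -> X0 `<=` X ->
    (forall z, X z -> exists g z0, X0 z0 /\ z = act g z0) ->
    (forall g z, X0 z -> X0 (act g z) <-> S g) ->
  (orbits N X `*` cosets S (S `&` N) #=
   cosets setT N `*` orbits (S `&` N) X0)%card.
Proof.
move=> nN sS Xact X0X Xind X0S; have sN := normal_subgroup nN.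
have sD := subgroupI sS sN; pose D := S `&` N.
have NJ g n : N n -> N (g * n * g^-1) by apply: (normal_inner nN).
have NJV g n : N n -> N (g^-1 * n * g).
  by move=> Nn; rewrite -[X in _ * X]invgK; apply: NJ.
have DJ s d : S s -> D d -> D (s * d * s^-1).
  move=> Ss [Sd Nd]; split; last exact: NJ.
  by apply: sS.2 => //; apply: subgroupM.
have [XE|/set0P[zz Xzz]] := eqVneq X set0.
  have X0E : X0 = set0 by apply/seteqP; split=> // z /X0X; rewrite XE.
  by rewrite /orbits X0E XE !image_set0 set0X setX0 card_eq00.
have /choice[r rP] : forall w, exists kz : G * T, orbits N X w ->
    X0 kz.2 /\ w = orbit N (act kz.1 kz.2).
  move=> w; have [[z Xz <-]|nw] := pselect (orbits N X w);
    last by exists (1, zz).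
  by have [g [z0 [X0z ->]]] := Xind z Xz; exists (g, z0).
(* With [r w = (k, z)], a pair [(w, c)] is sent to [(w, c D)] and to [(k c^-1 N, D-orbit of c z)].
   These maps are onto the two sides and identify the same pairs. *)
pose P : set (set T * G) := orbits N X `*` S.
have -> : orbits N X `*` cosets S D = (fun u => (u.1, left_coset u.2 D)) @` P.
  apply/seteqP; split=> [[w Y] [/= Ow [c Sc <-]]|_ [[w c] [/= Ow Sc] <-]].
    by exists (w, c).
  by split=> //=; exists c.
have -> : cosets setT N `*` orbits D X0 = (fun u =>
    (left_coset ((r u.1).1 * u.2^-1) N, orbit D (act u.2 (r u.1).2))) @` P.
  apply/seteqP; split.
    move=> [Y Z] [/= [g _ <-] [z X0z <-]].
    have Ow : orbits N X (orbit N (act g z)).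
      by exists (act g z) => //; apply: Xact; apply: X0X.
    have [X0w /orbitP-/(_ sN)[n Nn nE]] := rP _ Ow.
    set w := orbit N _ in Ow X0w nE.
    have cE : act (g^-1 * n^-1 * (r w).1) (r w).2 = z.
      by rewrite actM nE -!actM !gnorm act1.
    exists (w, g^-1 * n^-1 * (r w).1).
      by split=> //=; apply/(X0S _ _ X0w); rewrite cE.
    congr (_, _); rewrite /= ?cE//; apply/left_cosetP => //.
    by move: (NJV g n^-1 (subgroupV sN Nn)); congr N; rewrite !gnorm.
  move=> _ [[w c] [/= Ow Sc] <-].
  have [X0z _] := rP w Ow; split=> /=; first by exists ((r w).1 * c^-1).
  by exists (act c (r w).2) => //; apply/X0S.
apply: card_eq_image => -[w c] [w' c'] /= [/= Ow Sc] [/= Ow' Sc'].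
have [X0z wE] := rP w Ow; have [X0z' wE'] := rP w' Ow'.
split=> [[<- /left_cosetP-/(_ sD)[Scc Ncc]]|[/left_cosetP-/(_ sN) Nkk]].
  congr (_, _); [apply/left_cosetP|apply/orbitP] => //.
    rewrite (_ : _ * _ = c * (c^-1 * c')^-1 * c^-1); last by rewrite !gnorm.
    by apply: NJ; apply: subgroupV.
  exists (c * (c^-1 * c') * c^-1); first exact: DJ.
  by rewrite -actM !gnorm.
move=> /orbitP-/(_ sD)[d [Sd Nd] zE].
have ww' : w = w'.
  rewrite wE wE'; apply/orbitP => //.
  exists ((r w).1 * c^-1 * (((r w).1 * c^-1)^-1 * ((r w').1 * c'^-1) * d) *
    ((r w).1 * c^-1)^-1).
    by apply: NJ; apply: subgroupM.
  rewrite -[(r w').2](actK c') zE -!actM; congr (act _ _).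
  by rewrite !gnorm.
rewrite -ww' in Nkk *; congr (_, _); apply/left_cosetP => //; split.
  by apply: subgroupM => //; apply: subgroupV.
move: (NJV c _ (subgroupV sN Nkk)); congr N; by rewrite !gnorm.
Qed.

End Actions.

(** * The tamed Reidemeister number *)

Section Reidemeister.
Variables (G : groupType) (f : G -> G).
Hypothesis fM : forall x y, f (x * y) = f x * f y.
Implicit Types (A B C D K S N : set G) (x y g h t : G) (p : G * G).

Let f1 : f 1 = 1 := morph_mul1 fM.
Let fV x : f x^-1 = (f x)^-1 := morph_mulV fM x.

Definition tact g x := g * x * (f g)^-1.

Lemma tact1 x : tact 1 x = x.
Proof. by rewrite /tact f1 invg1 mul1g mulg1. Qed.

Lemma tactM g h x : tact (g * h) x = tact g (tact h x).
Proof. by rewrite /tact fM !gnorm. Qed.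

Definition pact g p := (inner g p.1, tact g p.2).

Lemma pact1 p : pact 1 p = p.
Proof. by case: p => t x; rewrite /pact tact1 /inner mul1g invg1 mulg1. Qed.

Lemma pactM g h p : pact (g * h) p = pact g (pact h p).
Proof. by case: p => t x; rewrite /pact /= tactM /inner !gnorm. Qed.

Definition fix_pairs : set (G * G) := [set p | p.1 = inner p.2 (f p.1)].

Lemma fix_pairs_stab t x : fix_pairs (t, x) <-> tact t x = x.
Proof.
rewrite /fix_pairs /tact /inner /=; split=> tE.
  by rewrite {1}tE !gnorm.
by rewrite -{1}tE !gnorm.
Qed.

Lemma fix_pairs_act g p : fix_pairs p -> fix_pairs (pact g p).
Proof.
case: p => t x; rewrite /fix_pairs /pact /tact /inner /= => tE.
by rewrite {1}tE !fM fV !gnorm.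
Qed.

Lemma twistedM x y z :
  (inner x \o f) (y * z) = (inner x \o f) y * (inner x \o f) z.
Proof. by rewrite /= fM innerM. Qed.

Lemma twisted_classE x : twisted_class f x = orbit tact setT x.
Proof.
by apply/seteqP; split=> [_ [h ->]|_ [h _ <-]]; exists h.
Qed.

Lemma twisted_class_tact g x : twisted_class f (tact g x) = twisted_class f x.
Proof.
rewrite !twisted_classE; apply/esym/(orbitP tact1 tactM _ _ (subgroupT G)).
by exists g.
Qed.

Lemma twisted_class_eq x y : twisted_class f x = twisted_class f y <->
  exists g, y = tact g x.
Proof.
rewrite !twisted_classE orbitP//; [|exact: tact1|exact: tactM].
by split=> [[g _ ->]|[g ->]]; exists g.
Qed.

Lemma reidemeister_classesE : (fun p => twisted_class f p.2) @` fix_pairs =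
  reidemeister_classes f.
Proof.
apply/seteqP; split=> [_ [p _ <-]|_ [x _ <-]]; first by exists p.2.
by exists (1, x) => //; apply/fix_pairs_stab; rewrite tact1.
Qed.

(** * Orbits of the normal NR-subgroup *)

Section NRsubgroup.
Variable N : set G.
Hypotheses (nN : normal_in N setT) (fN : finite_index setT N).
Hypothesis NR_N : NR_group N.
Hypothesis stN : forall x, N x -> N (f x).
Hypothesis hR : reidemeister_finite f.
Let sN : subgroup N := normal_subgroup nN.

Lemma index_gt0 S : subgroup S -> (0 < subgroup_index S (S `&` N))%N.
Proof.
move=> sS; apply: (@ncard_gt0 _ _ (left_coset 1 (S `&` N))).
  exact: finite_index_sub.
by exists 1 => //; apply: subgroup1.
Qed.

Definition stab x : set G := [set g | tact g x = x].

Lemma stab_subgroup x : subgroup (stab x).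
Proof.
split=> [|g h /= gx hx]; first exact: tact1.
have hVx : tact h^-1 x = x by rewrite -{1}hx -tactM mulVg tact1.
by rewrite /stab /= tactM hVx.
Qed.

(** Each twisted class is induced from one point [x] with its stabilizer, so it splits into finitely
    many [N]-orbits, [N] being of finite index. *)
Lemma finite_orbits : finite_set (orbits tact N setT).
Proof.
apply: (orbits_finite (p := twisted_class f)).
  by apply: sub_finite_set hR => _ [x _ <-]; exists x.
move=> _ [x _ <-]; set X := _ `&` _.
have sS := stab_subgroup x.
have card : (orbits tact N X `*` cosets (stab x) (stab x `&` N) #=
    cosets setT N `*` orbits tact (stab x `&` N) [set x])%card.
  apply: (card_orbits_induced tact1 tactM nN sS).
  - by move=> g z [_ /= zx]; split=> //=; rewrite twisted_class_tact.
  - by move=> _ ->.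
  - by move=> z [_ /esym/twisted_class_eq[g ->]]; exists g, x.
  - by move=> g z ->.
apply: (@finite_setX_l _ _ _ (cosets (stab x) (stab x `&` N))
  (left_coset 1 (stab x `&` N))).
  by exists 1; first exact: subgroup1.
rewrite (eq_finite_set card); apply: finite_setX => //.
by rewrite /orbits image_set1; exact: finite_set1.
Qed.

(** [u |-> u x] turns conjugacy twisted by [iota_x f] on [N] into the [N]-orbits in [N x]. *)
Lemma finite_tw_classes x : finite_set (tw_classes N (inner x \o f)).
Proof.
have card : ((fun u => orbit tact N (u * x)) @` N #=
    tw_classes N (inner x \o f))%card.
  apply: card_eq_image => u v Nu Nv.
  rewrite (orbitP tact1 tactM _ _ sN) (tw_class_eq _ _ (twistedM x) sN).
  split=> -[h Nh vE]; exists h => //.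
    by apply: (mulIg x); rewrite vE /tact /inner /= !gnorm.
  by rewrite vE /tact /inner /= !gnorm.
rewrite -(eq_finite_set card); apply: sub_finite_set finite_orbits.
by move=> _ [u _ <-]; exists (u * x).
Qed.

Lemma fix_N x h : N h -> inner x (f h) = h -> h = 1.
Proof.
have inN y : N y -> N ((inner x \o f) y).
  by move=> Ny; apply: (normal_inner nN) => //; apply: stN.
have [_ fixN] := tau_count NR_N sN (@subset_refl _ N) (twistedM x) inN
  (finite_tw_classes x).
exact: fixN.
Qed.

Lemma stab_fix x g : stab x g <-> inner x (f g) = g.
Proof.
rewrite -[stab x g]/(tact g x = x) -fix_pairs_stab /fix_pairs /=.
by split=> /esym.
Qed.

Lemma stabIN x : stab x `&` N = [set 1].
Proof.
apply/seteqP; split=> [g [/stab_fix gx Ng]|_ ->]; first exact: fix_N gx.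
by split; [exact: tact1 | exact: subgroup1].
Qed.

(** These pairs are induced from the pairs [(t, x)] with [t] in [stab x]. As [N] meets [stab x]
    trivially, the order of [stab x] appears on both sides of the count and cancels. *)
Lemma fibre_twisted_class x :
  let X := fix_pairs `&`
    (fun p => twisted_class f p.2) @^-1` [set twisted_class f x] in
  finite_set (orbits pact N X) /\
  ncard (orbits pact N X) = subgroup_index setT N.
Proof.
move=> X; have sS := stab_subgroup x; pose X0 := [set (t, x) | t in stab x].
have fS := finite_index_sub sS sN fN.
have := @card_orbits_induced _ _ pact pact1 pactM N (stab x) X X0 nN sS.
rewrite stabIN in fS *; move=> card.
have {}card : (orbits pact N X `*` cosets (stab x) [set 1] #=
    cosets setT N `*` orbits pact [set 1] X0)%card.
  apply: card.
  - move=> g p [Xp /= px]; split; first exact: fix_pairs_act.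
    by rewrite /= twisted_class_tact.
  - by move=> _ [t tx <-]; split=> //; apply/fix_pairs_stab.
  - move=> [t y] [ty /= /esym/twisted_class_eq[g yE]].
    exists g, (inner g^-1 t, x); split; last first.
      by rewrite /pact /= -yE /inner !gnorm.
    exists (inner g^-1 t) => //; apply/fix_pairs_stab.
    have := fix_pairs_act g^-1 ty; rewrite /pact /= yE -tactM mulVg tact1.
    by [].
  move=> g _ [t tx <-]; split=> [[s sx [_ /esym]]//|gx].
  have ggx : tact g x = x by [].
  exists (inner g t); last by rewrite /pact /= ggx.
  by rewrite /inner; apply: sS.2 => //; apply: subgroupM.
have s1 := subgroup_set1 G.
have cosS : (cosets (stab x) [set 1] #= stab x)%card.
  apply: inj_card_eq => g h _ _ /left_cosetP-/(_ s1) /= gh.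
  by apply: (mulgI g^-1); rewrite mulVg gh.
have [finS cardS] := card_eq_ncard cosS fS.
have orbX0 : (stab x #= orbits pact [set 1] X0)%card.
  rewrite /orbits /X0 image_comp; apply/card_esym/inj_card_eq => g h _ _ /=.
  by move=> /(orbitP pact1 pactM _ _ s1)[_ -> ]; rewrite pact1 => -[].
have [finO cardO] := card_eq_ncard orbX0 finS.
have finR : finite_set (cosets setT N `*` orbits pact [set 1] X0)
  by exact: finite_setX.
have finL : finite_set (orbits pact N X `*` cosets (stab x) [set 1]).
  by rewrite (eq_finite_set card).
have finX : finite_set (orbits pact N X).
  apply: finite_setX_l finL; exists 1 => //; exact: tact1.
split=> //; have [_] := card_eq_ncard card finL.
rewrite !ncardX// cardS -cardO => /eqP; rewrite eqn_pmul2r; first by move/eqP.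
by apply: (ncard_gt0 finS (x := 1)); exact: tact1.
Qed.

Lemma ncard_fix_pairs : finite_set (orbits pact N fix_pairs) /\
  ncard (orbits pact N fix_pairs) =
    (reidemeister_number f * subgroup_index setT N)%N.
Proof.
have pK k p : N k -> fix_pairs p ->
  twisted_class f (pact k p).2 = twisted_class f p.2.
  by move=> _ _; rewrite /= twisted_class_tact.
have finX : finite_set (orbits pact N fix_pairs).
  apply: (orbits_finite (p := fun p => twisted_class f p.2));
    first by rewrite reidemeister_classesE.
  by move=> _ [p _ <-]; have [] := fibre_twisted_class p.2.
split=> //; rewrite (ncard_orbits pact1 sN pK (1, 1))// reidemeister_classesE.
rewrite (eq_big_seq (fun=> subgroup_index setT N)) => [|C].
  by rewrite big_const_seq count_predT iter_addn_0 mulnC.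
by rewrite in_fset_set// inE => -[x _ <-]; have [] := fibre_twisted_class x.
Qed.

Lemma conj_class_eq t u : conj_class t = conj_class u <->
  exists g, u = inner g t.
Proof.
split=> [tu|[g ->]].
  have : conj_class u u by exists 1; rewrite /inner mul1g invg1 mulg1.
  by rewrite -tu.
apply/seteqP; split=> _ [h ->]; last by exists (h * g); rewrite /inner !gnorm.
by exists (h * g^-1); rewrite /inner !gnorm.
Qed.

Lemma class_map_conj t : class_map f (conj_class t) = conj_class (f t).
Proof.
apply/seteqP; split=> [y [_ [g ->]]|y fty]; last first.
  by exists t => //; exists 1; rewrite /inner mul1g invg1 mulg1.
rewrite (_ : conj_class (f (inner g t)) = conj_class (f t))//.
by apply/esym/conj_class_eq; exists (f g); rewrite /inner !fM fV.
Qed.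

(** If [t] stabilizes [x], then [x] witnesses that the class of [t] is fixed, and [t] is torsion: a
    power of it lies in [N], where [iota_x f] fixes only 1. Conversely, a witness [g] for [t] gives
    the pair [(t, g)]. *)
Lemma fixed_torsion_classesE :
  (fun p => conj_class p.1) @` fix_pairs = fixed_torsion_classes f.
Proof.
apply/seteqP; split=> [_ [[t x] tx <-]|C [[t tt <-]]] /=; last first.
  rewrite class_map_conj => /conj_class_eq[g tE].
  by exists (t, g).
have /fix_pairs_stab stx := tx; split.
  exists t => //; have [k k0 Nk] := finite_index_torsion t sN fN.
  exists k => //; apply: (@fix_N x) => //; apply/stab_fix.
  exact: subgroupX (stab_subgroup x) _.
by rewrite class_map_conj; apply/conj_class_eq; exists x.
Qed.

Lemma centralizer_subgroup t : subgroup (centralizer t).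
Proof.
split=> [|x y /= xt yt]; first by rewrite /centralizer /= mul1g mulg1.
apply: commute_sym; apply: commuteM; first exact: commute_sym.
by apply/commuteV/commute_sym.
Qed.

Lemma centralizerP t x : centralizer t x <-> inner x t = t.
Proof.
rewrite /centralizer /inner /=; split=> [->|xt]; first by rewrite mulgK.
by rewrite -{2}xt mulgVK.
Qed.

(** * Pairs over one fixed torsion class *)

Section Class.
Variables (t g : G) (C : set G).
Hypotheses (Ct : C = conj_class t) (tg : t = inner g (f t)).
Let S := centralizer t.
Let D := S `&` N.
Let sS : subgroup S := centralizer_subgroup t.
Let sD : subgroup D := subgroupI sS sN.
Let X0 : set (G * G) := fix_pairs `&` [set p | p.1 = t].

(** The pairs over [C] are induced from those with first coordinate [t], whose stabilizer under
    conjugation is [S]. *)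
Lemma fibre_conj_class :
  let X := fix_pairs `&` (fun p => conj_class p.1) @^-1` [set C] in
  finite_set (orbits pact D X0) /\
  (ncard (orbits pact N X) * subgroup_index S D =
   subgroup_index setT N * ncard (orbits pact D X0))%N.
Proof.
move=> X; have [finP _] := ncard_fix_pairs.
have finX : finite_set (orbits pact N X).
  by apply: sub_finite_set finP => _ [p [Xp _] <-]; exists p.
have finS := finite_index_sub sS sN fN.
have card : (orbits pact N X `*` cosets S D #=
    cosets setT N `*` orbits pact D X0)%card.
  apply: (card_orbits_induced pact1 pactM nN sS).
  - move=> h p [Xp /= pC]; split; first exact: fix_pairs_act.
    by rewrite /= -pC; apply/esym/conj_class_eq; exists h.
  - by move=> [u x] [ux /= ut]; split=> //=; rewrite ut Ct.
  - move=> [u x] [ux]; rewrite /= Ct => /esym/conj_class_eq[h uE].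
    exists h, (pact h^-1 (u, x)); rewrite (actVK pact1 pactM); split=> //.
    split; first exact: fix_pairs_act.
    by rewrite /= uE /inner !gnorm.
  - move=> h [u x] [ux /= ut]; rewrite /S centralizerP.
    split=> [[_ /=]|ht]; first by rewrite ut.
    by split; [exact: fix_pairs_act | rewrite /= ut].
have finL : finite_set (orbits pact N X `*` cosets S D) by exact: finite_setX.
have [finR] := card_eq_ncard card finL.
have finO : finite_set (orbits pact D X0).
  by apply: finite_setX_r finR; exists 1.
by rewrite !ncardX.
Qed.

(** [(t, x)] is a fixed pair exactly when [x g^-1] lies in [S], and the coset of [D] containing it
    is constant on [D]-orbits. Over the coset [k D] one has [x = u k g] with [u] in [D], and [D]
    acts on [u] by conjugacy twisted by [iota_k iota_g f], which [tau_count] counts. *)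
Lemma ncard_class_orbits (c : set G -> G) :
  (forall Y, cosets S D Y -> Y (c Y)) ->
  ncard (orbits pact D X0) = (\sum_(Y <- fset_set (cosets S D))
    tau D (inner (c Y) \o (inner g \o f)))%N.
Proof.
move=> cP; have [finO _] := fibre_conj_class.
pose p (z : G * G) := left_coset (z.2 * g^-1) D.
have X0P x : X0 (t, x) <-> S (x * g^-1).
  have xgE : inner (x * g^-1) t = inner x (f t) by rewrite {1}tg /inner !gnorm.
  rewrite /S centralizerP xgE; split=> [[tx _]|tx]; first exact: esym.
  by split=> //; exact: esym.
have psiS h : S h -> S (inner g (f h)).
  move=> /centralizerP hS; apply/centralizerP.
  have -> : inner (inner g (f h)) t = inner g (f (inner h t)).
    by rewrite {1}tg /inner !fM fV !gnorm.
  by rewrite hS -tg.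
have psiD h : D h -> D (inner g (f h)).
  move=> [Sh Nh]; split; first exact: psiS.
  by apply: (normal_inner nN) => //; apply: stN.
have DJ s h : S s -> D h -> D (inner s h).
  move=> Ss [Sh Nh]; split; last exact: (normal_inner nN).
  by apply: sS.2 => //; apply: subgroupM.
have pK h z : D h -> X0 z -> p (pact h z) = p z.
  case: z => u x Dh [ux /= uE]; rewrite uE in ux *.
  have Sx : S (x * g^-1) by apply/X0P; split.
  apply/(left_cosetP _ _ sD) => /=.
  rewrite (_ : (tact h x * g^-1)^-1 * (x * g^-1) =
    inner g (f h) * inner (x * g^-1)^-1 h^-1); last first.
    by rewrite /tact /inner !gnorm.
  apply: subgroupM => //; first exact: psiD.
  by apply: DJ; apply: subgroupV.
rewrite (ncard_orbits pact1 sD pK (1, 1))//.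
have -> : p @` X0 = cosets S D.
  apply/seteqP; split=> [_ [[u x] [ux /= uE] <-]|_ [s Ss <-]].
    by rewrite uE in ux; exists (x * g^-1) => //; apply/X0P; split.
  by exists (t, s * g); [apply/X0P; rewrite mulgK | rewrite /p /= mulgK].
apply: eq_big_seq => Y; rewrite in_fset_set ?inE; last exact: finite_index_sub.
move=> SY; have cY := cP Y SY; have [s Ss sY] := SY.
have Sc : S (c Y).
  by move: cY; rewrite -{1}sY => -[h [Sh _] <-]; apply: subgroupM.
have YE : Y = left_coset (c Y) D.
  rewrite -{1}sY; apply/left_cosetP => //; move: cY;
    rewrite -{1}sY => -[h Dh <-].
  by rewrite mulKg.
set k := c Y in cY Sc YE *; set psi := inner k \o (inner g \o f).
have psiM x y : psi (x * y) = psi x * psi y by rewrite /psi /= fM !innerM.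
have XE : X0 `&` p @^-1` [set Y] = (fun u => (t, u * k * g)) @` D.
  apply/seteqP; split=> [[u x] [[ux /= uE]]|_ [u [Su Nu] <-]].
    rewrite uE in ux *; rewrite YE => /left_cosetP-/(_ sD) Dx.
    exists (x * g^-1 * k^-1); last by rewrite !gnorm.
    rewrite (_ : x * g^-1 * k^-1 = inner k ((x * g^-1)^-1 * k)^-1);
      last by rewrite /inner !gnorm.
    by apply: DJ => //; apply: subgroupV.
  split; first by apply/X0P; rewrite mulgK; apply: subgroupM.
  rewrite /= /p /= mulgK YE; apply/left_cosetP => //.
  rewrite (_ : (u * k)^-1 * k = inner k^-1 u^-1); last by rewrite /inner !gnorm.
  by apply: DJ; apply: subgroupV.
have card : (orbits pact D (X0 `&` p @^-1` [set Y]) #= tw_classes D psi)%card.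
  rewrite XE /orbits image_comp; apply: card_eq_image => u v [Su Nu] [Sv Nv] /=.
  rewrite (orbitP pact1 pactM _ _ sD) (tw_class_eq _ _ psiM sD).
  split=> -[h [Sh Nh] vE]; exists h => //.
    case: vE => _ /(congr1 (fun z => z * g^-1 * k^-1)); rewrite !mulgK => ->.
    by rewrite /tact /psi /inner /= !gnorm.
  rewrite /pact /= (centralizerP t h).1// vE; congr (_, _).
  by rewrite /tact /psi /inner /= !gnorm.
have fin : finite_set (orbits pact D (X0 `&` p @^-1` [set Y])).
  by apply: sub_finite_set finO => _ [z [Xz _] <-]; exists z.
have [finT ->] := card_eq_ncard card fin.
have psiDk h : D h -> D (psi h) by move=> /psiD; apply: DJ.
have DN : D `<=` N by move=> x [].
by have [] := tau_count NR_N sD DN psiM psiDk finT.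
Qed.

End Class.

End NRsubgroup.
End Reidemeister.

Theorem proposition4p4 (G : groupType) (phi : UMagmaMorphism.type G G)
    (hG : virtually_polycyclic G) (hR : reidemeister_finite phi)
    (d : tamed_choice phi) :
  tamed_reidemeister d = ((reidemeister_number phi)%:R)%R.
Proof.
have phiM x y : phi (x * y) = phi x * phi y by exact: gmulfM.
set N := tame_N d; have nN : normal_in N setT := tame_N_normal d.
have fN : finite_index setT N := tame_N_finite_index d.
have NR_N : NR_group N := tame_N_NR d.
have stN : forall x, N x -> N (phi x) := @tame_N_stable _ _ d.
have sN := normal_subgroup nN.
have [finP cardP] := ncard_fix_pairs phiM nN fN NR_N stN hR.
have classesE := fixed_torsion_classesE phiM nN fN NR_N stN hR.
have pK k p : N k -> fix_pairs phi p ->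
    conj_class (pact phi k p).1 = conj_class p.1.
  by move=> _ _; apply/esym/conj_class_eq; exists k.
have pact1 := pact1 phiM.
have finC : finite_set (fixed_torsion_classes phi).
  by rewrite -classesE; apply: (orbits_finite_base pact1 sN pK (1, 1)).
have N_gt0 : (0 < subgroup_index setT N)%N.
  by have := index_gt0 nN fN (subgroupT G); rewrite setTI.
have N_neq0 : ((subgroup_index setT N)%:R != 0 :> rat)%R
  by rewrite pnatr_eq0 -lt0n.
(* After multiplication by [[G : N]] the right-hand side counts the [N]-orbits on [fix_pairs]; both
   sides are then compared class by class. *)
apply: (mulIf N_neq0); rewrite -natrM -cardP.
rewrite (ncard_orbits pact1 sN pK (1, 1) finP) classesE natr_sum.
rewrite /tamed_reidemeister fsbig_finite// mulr_suml; apply: eq_big_seq => C.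
rewrite in_fset_set// inE => fixC.
set t := tame_t d C; set g := tame_g d C.
have CE : C = conj_class t.
  have [[t0 _ t0C] _] := fixC; have := tame_t_in d fixC;
    rewrite -/t -t0C => -[h tE].
  by apply/conj_class_eq; exists h.
have tg : t = inner g (phi t) := tame_t_fix d fixC.
have [_ cardX] := fibre_conj_class phiM nN fN NR_N stN hR CE.
have sD := subgroupI (centralizer_subgroup t) sN.
have finS := finite_index_sub (centralizer_subgroup t) sN fN.
have S_neq0 :
    ((subgroup_index (centralizer t) (centralizer t `&` N))%:R != 0 :> rat)%R.
  by rewrite pnatr_eq0 -lt0n (index_gt0 nN fN (centralizer_subgroup t)).
have cP Y : cosets (centralizer t) (centralizer t `&` N) Y -> Y (tame_c d C Y).
  exact: tame_c_in.
have cardO := ncard_class_orbits phiM nN fN NR_N stN hR CE tg cP.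
rewrite /tamed_term -/t -/g -/N fsbig_finite//= -natr_sum -cardO.
(* Multiplication by [[C_t : D_t]] clears the remaining denominator and leaves [cardX]. *)
apply: (mulfI S_neq0); rewrite mulrA mulVKf// mulrC -!natrM.
by congr (_%:R)%R; rewrite -cardX mulnC.
Qed.
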